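(* It is provable in $\mathbf{ZF}$ (without the axiom of choice) that the following conditions are all equivalent: (i) for every infinite set $X$, the set $[X]^{<\omega}$ of all finite subsets of $X$ has a denumerable subset; (ii) every infinite zero-dimensional Hausdorff space admits a denumerable cellular family; (iii) for every infinite set $X$, every infinite subspace $\mathbf{Y}$ of the Cantor cube $\mathbf{2}^{X}$ admits a denumerable cellular family; (iv) for every infinite set $X$, the Cantor cube $\mathbf{2}^{X}$ admits a denumerable cellular family.
   Context: The base theory is $\mathbf{ZF}$, with no form of the axiom of choice assumed. A set is finite if it is equipotent with some $n\in\omega$, infinite if it is not finite, and denumerable if it is equipotent with $\omega$. A cellular family of a topological space is a set of pairwise disjoint non-empty open subsets of it. A space is zero-dimensional if it has a base consisting of clopen sets. The Cantor cube $\mathbf{2}^{X}$ is the set $\{0,1\}^X$ with the Tychonoff product topology, where $\{0,1\}$ is discrete. *)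

(* Defs.v *)
From mathcomp Require Import all_boot.
From Stdlib Require List.

(* First-order classical logic with equality over the single binary relation
   symbol of set membership.  Variables are de Bruijn indices; the language has
   no function symbols, so terms are variables and substitution is renaming. *)

Inductive form : Type :=
| Bot : form
| Mem : nat -> nat -> form
| Eq : nat -> nat -> form
| Imp : form -> form -> form
| All : form -> form.

Definition Not p := Imp p Bot.
Definition And p q := Not (Imp p (Not q)).
Definition Or p q := Imp (Not p) q.
Definition Iff p q := And (Imp p q) (Imp q p).
Definition Ex p := Not (All (Not p)).

Declare Scope form_scope.
Delimit Scope form_scope with form.
Bind Scope form_scope with form.

Notation "x ∈ y" := (Mem x%N y%N) (at level 50, no associativity) : form_scope.
Notation "x ≡ y" := (Eq x%N y%N) (at level 50, no associativity) : form_scope.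
Notation "¬ p" := (Not p) (at level 55, right associativity) : form_scope.
Notation "p ∧ q" := (And p q) (at level 60, right associativity) : form_scope.
Notation "p ∨ q" := (Or p q) (at level 61, right associativity) : form_scope.
Notation "p ⇒ q" := (Imp p q) (at level 65, right associativity) : form_scope.
Notation "p ⇔ q" := (Iff p q) (at level 66, no associativity) : form_scope.
Notation "∀' p" := (All p) (at level 70, right associativity) : form_scope.
Notation "∃' p" := (Ex p) (at level 70, right associativity) : form_scope.
(* In the body of a bounded quantifier index 0 is the bound element, and every
   index from outside has to be increased by one. *)
Notation "∀∈ x , p" := (All (Imp (Mem 0 x.+1) p))
  (at level 70, x at level 9, right associativity) : form_scope.
Notation "∃∈ x , p" := (Ex (And (Mem 0 x.+1) p))
  (at level 70, x at level 9, right associativity) : form_scope.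

Local Open Scope form_scope.

Definition up (r : nat -> nat) (n : nat) : nat :=
  if n is m.+1 then (r m).+1 else 0.

Fixpoint ren (r : nat -> nat) (p : form) : form :=
  match p with
  | Bot => Bot
  | Mem x y => Mem (r x) (r y)
  | Eq x y => Eq (r x) (r y)
  | Imp p q => Imp (ren r p) (ren r q)
  | All p => All (ren (up r) p)
  end.

(* [inst t p] replaces index 0 of [p] by the variable [t]. *)
Definition inst (t : nat) : form -> form :=
  ren (fun n => if n is m.+1 then m else t).

(* Natural deduction from hypotheses [G] over the non-logical axioms [T].  The
   axioms are not affected by the eigenvariable condition of [AllI], so that an
   axiom with free variables stands for its universal closure. *)
Inductive prv (T : form -> Prop) : seq form -> form -> Prop :=
| Hyp G p : List.In p G -> prv T G p
| Ax G p : T p -> prv T G p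
| ImpI G p q : prv T (p :: G) q -> prv T G (p ⇒ q)
| ImpE G p q : prv T G (p ⇒ q) -> prv T G p -> prv T G q
| Raa G p : prv T (¬ p :: G) Bot -> prv T G p
| AllI G p : prv T (map (ren succn) G) p -> prv T G (∀' p)
| AllE G p t : prv T G (∀' p) -> prv T G (inst t p)
| EqI G x : prv T G (x ≡ x)
| EqE G p x y : prv T G (x ≡ y) -> prv T G (inst x p) -> prv T G (inst y p).

Notation "T ⊢ p" := (prv T [::] p%form) (at level 75, no associativity).

(* Elementary set theory.  The arguments of each formula are the indices of its
   free variables. *)

Definition Sub x y := ∀∈ x, 0 ∈ y.+1.
Definition Empty x := ∀' ¬ (0 ∈ x.+1).
Definition Disjoint x y := ∀' ¬ (0 ∈ x.+1 ∧ 0 ∈ y.+1).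

(* z = x ∩ y, z = x \ y, z = ⋃ x, y = x ∪ {x} *)
Definition Inter z x y := ∀' (0 ∈ z.+1 ⇔ 0 ∈ x.+1 ∧ 0 ∈ y.+1).
Definition Diff z x y := ∀' (0 ∈ z.+1 ⇔ 0 ∈ x.+1 ∧ ¬ (0 ∈ y.+1)).
Definition Union z x := ∀' (0 ∈ z.+1 ⇔ ∃∈ x.+1, 1 ∈ 0).
Definition Succ y x := ∀' (0 ∈ y.+1 ⇔ 0 ∈ x.+1 ∨ 0 ≡ x.+1).

(* z = {x, y}, z = (x, y) = {{x}, {x, y}} *)
Definition Upair z x y := ∀' (0 ∈ z.+1 ⇔ 0 ≡ x.+1 ∨ 0 ≡ y.+1).
Definition Opair z x y :=
  ∃' ∃' (Upair 1 x.+2 x.+2 ∧ Upair 0 x.+2 y.+2 ∧ Upair z.+2 1 0).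

Definition Inductive_set x := (∃∈ x, Empty 0) ∧ (∀∈ x, ∃∈ x.+1, Succ 0 1).

(* w = ω, the least inductive set *)
Definition Omega w := Inductive_set w ∧ (∀' (Inductive_set 0 ⇒ Sub w.+1 0)).

Inductive ZF : form -> Prop :=
| Extensionality : ZF (∀' ∀' ((∀' (0 ∈ 1 ⇔ 0 ∈ 2)) ⇒ 0 ≡ 1))
| Foundation : ZF (∀' (¬ Empty 0 ⇒ ∃∈ 0, Disjoint 0 1))
| Pairing : ZF (∀' ∀' ∃' Upair 0 1 2)
| Unions : ZF (∀' ∃' Union 0 1)
| Powerset : ZF (∀' ∃' ∀' (0 ∈ 1 ⇔ Sub 0 2))
| Infinity : ZF (∃' Inductive_set 0)
(* ∀x ∃y ∀z (z ∈ y ⇔ z ∈ x ∧ p), where in [p] index 0 is z, index 1 is x, the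
   others are parameters, and y does not occur *)
| Separation (p : form) :
    ZF (∀' ∃' ∀' (0 ∈ 1 ⇔ 0 ∈ 2 ∧ ren (up succn) p))
(* ∀x ∀y ∀y' (p(x,y) ∧ p(x,y') ⇒ y = y') ⇒ ∀a ∃b ∀y (y ∈ b ⇔ ∃x ∈ a, p(x,y)),
   where in [p] index 0 is y, index 1 is x, the others are parameters, and
   neither a nor b occurs *)
| Replacement (p : form) :
    ZF ((∀' ∀' ∀' (ren succn p ∧ ren (up succn) p ⇒ 1 ≡ 0))
        ⇒ ∀' ∃' ∀' (0 ∈ 1 ⇔ ∃∈ 2,
             ren (fun n => match n with 0 => 1 | 1 => 0 | m.+2 => m.+4 end) p)).

(* f(x) = y *)
Definition App f x y := ∃∈ f, Opair 0 x.+1 y.+1.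

(* f : x -> y *)
Definition Fun f x y :=
  (∀∈ f, ∃∈ x.+1, ∃∈ y.+2, Opair 2 1 0)
  ∧ (∀∈ x, ∃∈ y.+1, (App f.+2 1 0 ∧ (∀' (App f.+3 2 0 ⇒ 0 ≡ 1)))).

Definition Bij f x y :=
  Fun f x y
  ∧ (∀∈ y, ∃∈ x.+1, (App f.+2 0 1 ∧ (∀' (App f.+3 0 2 ⇒ 0 ≡ 1)))).

Definition Equipotent x y := ∃' Bij 0 x.+1 y.+1.
Definition Finite x := ∃' (Omega 0 ∧ (∃∈ 0, Equipotent x.+2 0)).
Definition Infinite x := ¬ Finite x.
Definition Denumerable x := ∃' (Omega 0 ∧ Equipotent x.+1 0).

(* z = [x]^{<ω} *)
Definition FinSubsets z x := ∀' (0 ∈ z.+1 ⇔ Sub 0 x.+1 ∧ Finite 0).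

(* Topological spaces (x, t) with underlying set x and set of open sets t *)

Definition Topology t x :=
  (∀∈ t, Sub 0 x.+1)
  ∧ (∃∈ t, Empty 0)
  ∧ x ∈ t
  ∧ (∀' (Sub 0 t.+1 ⇒ ∃∈ t.+1, Union 0 1))
  ∧ (∀∈ t, ∀∈ t.+1, ∃∈ t.+2, Inter 0 2 1).

Definition Hausdorff t x :=
  ∀∈ x, ∀∈ x.+1, (¬ (1 ≡ 0) ⇒
    ∃∈ t.+2, ∃∈ t.+3, (3 ∈ 1 ∧ 2 ∈ 0 ∧ Disjoint 1 0)).

Definition Clopen u t x := u ∈ t ∧ (∃∈ t, Diff 0 x.+1 u.+1).

Definition Base b t := Sub b t ∧ (∀∈ t, ∃' (Sub 0 b.+2 ∧ Union 1 0)).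

Definition ZeroDimensional t x :=
  ∃' (Base 0 t.+1 ∧ (∀∈ 0, Clopen 0 t.+2 x.+2)).

(* s is the subspace topology on the subset y of a space with topology t. *)
Definition Subspace s y t := ∀' (0 ∈ s.+1 ⇔ ∃∈ t.+1, Inter 1 0 y.+2).

Definition Cellular c t :=
  Sub c t
  ∧ (∀∈ c, ¬ Empty 0)
  ∧ (∀∈ c, ∀∈ c.+1, (¬ (1 ≡ 0) ⇒ Disjoint 1 0)).

Definition DenumerableCellularFamily t := ∃' (Denumerable 0 ∧ Cellular 0 t.+1).

(* z = {0, 1} with 0 = ∅ and 1 = {∅} *)
Definition Two z := ∃' ∃' (Empty 1 ∧ Upair 0 1 1 ∧ Upair z.+2 1 0).

(* c = y^x, the set of all functions from x to y *)
Definition FunSpace c x y := ∀' (0 ∈ c.+1 ⇔ Fun 0 x.+1 y.+1).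

(* s = {f ∈ c : f(a) ∈ u}, the preimage of u under the projection at a *)
Definition Preimage s c a u :=
  ∀' (0 ∈ s.+1 ⇔ 0 ∈ c.+1 ∧ (∃∈ u.+1, App 1 a.+2 0)).

(* With respect to t, all projections from c, a set of functions from x to the
   discrete space y, are continuous. *)
Definition ContinuousProjections t c x y :=
  ∀∈ x, ∀' (Sub 0 y.+2 ⇒ ∃∈ t.+2, Preimage 0 c.+3 2 1).

(* c = {0,1}^x and t is its product topology: the coarsest topology for which
   all projections to the discrete space {0,1} are continuous. *)
Definition CantorCube c t x :=
  ∃' (Two 0
      ∧ FunSpace c.+1 x.+1 0
      ∧ Topology t.+1 c.+1
      ∧ ContinuousProjections t.+1 c.+1 x.+1 0
      ∧ (∀' (Topology 0 c.+2 ∧ ContinuousProjections 0 c.+2 x.+2 1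
             ⇒ Sub t.+2 0))).

(* The four conditions, as sentences; the comments give the variable names in
   the order of the quantifiers. *)

(* X, z = [X]^{<ω}, d *)
Definition FinSubsets_condition :=
  ∀' (Infinite 0 ⇒ ∀' (FinSubsets 0 1 ⇒ ∃' (Sub 0 1 ∧ Denumerable 0))).

(* X, t *)
Definition ZeroDimensional_condition :=
  ∀' ∀' (Topology 0 1 ∧ Infinite 1 ∧ ZeroDimensional 0 1 ∧ Hausdorff 0 1
         ⇒ DenumerableCellularFamily 0).

(* X, c = {0,1}^X, t, Y, s *)
Definition CantorSubspace_condition :=
  ∀' (Infinite 0 ⇒ ∀' ∀' (CantorCube 1 0 2 ⇒
    ∀' (Sub 0 2 ∧ Infinite 0 ⇒ ∀' (Subspace 0 1 2 ⇒
      DenumerableCellularFamily 0)))).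

(* X, c = {0,1}^X, t *)
Definition CantorCube_condition :=
  ∀' (Infinite 0 ⇒ ∀' ∀' (CantorCube 1 0 2 ⇒ DenumerableCellularFamily 0)).

(* Main.v *)
From mathcomp Require Import all_boot.
From Stdlib Require Import Classical ClassicalEpsilon.
From Stdlib Require Import FunctionalExtensionality PropExtensionality.
From Stdlib Require List.
Require Import Defs.

(* By Gödel's completeness theorem, which is proved here for the calculus [prv],
   it suffices to show that the four conditions are equivalent in every model of
   ZF.  Inside a model, separation and replacement are available for predicates
   definable with parameters.

   (i) => (ii).  Let B be the algebra of clopen sets of X, which is infinite
   because its members separate points, and let F_0, F_1, ... be distinct finite
   subsets of B.  Call x and y n-equivalent if they belong to the same members
   of the F_i with i < n; the n-equivalence classes are clopen.  If some x has
   classes C_0 ⊇ C_1 ⊇ ... that do not stabilise, the nonempty sets among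
   C_n \ C_(n+1) form a cellular family.  Otherwise, let V_n be the set of the
   points whose classes stabilise exactly from n on.  The V_n are open and
   disjoint, and infinitely many are nonempty: if n-equivalence were the same
   relation for all n >= N, all F_i would consist of unions of the finitely many
   N-equivalence classes.

   (iv) => (i).  Let C be a denumerable cellular family of 2^X.  For a finite
   subset A of X there are distinct o, o' in C with elements that agree on A,
   since otherwise C would embed into the power set of 2^A; choose the least such
   o.  For b : A -> 2 consider the finite sets s disjoint from A such that o
   contains a cylinder over A ∪ s whose restriction to A is b.  If o' also meets
   the cylinder of b, these sets have a finite hitting set, because a basic
   cylinder of o' must be incompatible with those of o.  There are only finitely
   many hitting sets of least size.  Adding all of them, for all b, to A yields a
   strictly larger finite set without any choice, and iterating from the empty
   set gives a denumerable set of finite sets. *)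

Set Implicit Arguments.
Unset Strict Implicit.
Unset Printing Implicit Defensive.

(** * Completeness of natural deduction *)

Arguments Hyp {T G p} _.
Arguments Ax {T} G {p} _.
Arguments ImpI {T G p q} _.
Arguments ImpE {T G p q} _ _.
Arguments Raa {T G p} _.
Arguments AllI {T G p} _.
Arguments AllE {T G p} t _.
Arguments EqI {T} G x.
Arguments EqE {T G p x y} _ _.

Definition scons {A : Type} (x : A) (e : nat -> A) (n : nat) : A :=
  if n is m.+1 then e m else x.

Local Notation "x .: e" := (scons x e) (at level 55, right associativity).

Lemma ren_comp p : forall r r', ren r (ren r' p) = ren (fun n => r (r' n)) p.
Proof.
elim: p => //= [p IHp q IHq|p IHp] r r'; first by rewrite IHp IHq.
by rewrite IHp; congr (All (ren _ p)); apply: functional_extensionality => -[].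
Qed.

Lemma ren_id p : ren (fun n => n) p = p.
Proof.
elim: p => //= [p -> q -> //|p {2}<-].
by congr (All (ren _ p)); apply: functional_extensionality => -[].
Qed.

(** A formula mentions finitely many variables. This yields fresh variables and reduces an arbitrary
    renaming to finitely many instantiations. *)
Lemma ren_bound p : exists N, forall r r',
  (forall n, n < N -> r n = r' n) -> ren r p = ren r' p.
Proof.
elim: p => [|x y|x y|p [N IHp] q [N' IHq]|p [N IHp]].
- by exists 0.
- exists (maxn x y).+1 => r r' rr' /=.
  by rewrite !rr' // ltnS leq_max leqnn ?orbT.
- exists (maxn x y).+1 => r r' rr' /=.
  by rewrite !rr' // ltnS leq_max leqnn ?orbT.
- exists (maxn N N') => r r' rr' /=; rewrite (IHp r r') ?(IHq r r') //.
    by move=> n nN; apply: rr'; rewrite leq_max nN orbT.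
  by move=> n nN; apply: rr'; rewrite leq_max nN.
- exists N => r r' rr' /=; rewrite (IHp _ (up r')) //.
  by case=> [//|n] nN /=; rewrite rr' // ltnW.
Qed.

(** States that [c] does not occur free in [p] through the action of renamings, without computing
    sets of free variables. *)
Definition fresh (c : nat) (p : form) :=
  forall r r', (forall n, n <> c -> r n = r' n) -> ren r p = ren r' p.

Lemma fresh_seq (G : seq form) : exists c, forall p, List.In p G -> fresh c p.
Proof.
suff [N NP] : exists N, forall p c, List.In p G -> N <= c -> fresh c p.
  by exists N => p /NP; apply.
elim: G => [|p G [N IH]]; first by exists 0.
have [M MP] := ren_bound p.
exists (maxn M N) => q c /= [<-|qG]; rewrite geq_max => /andP[Mc Nc].
  move=> r r' rr'; apply: MP => n nM; apply: rr' => nc.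
  by move: nM; rewrite nc ltnNge Mc.
exact: IH qG Nc.
Qed.

(** * Weakening, renaming and generalisation of derivations *)

Section Deduction.
Context (T : form -> Prop).

Lemma prv_weak G p : prv T G p ->
  forall G', (forall q, List.In q G -> List.In q G') -> prv T G' p.
Proof.
elim=> {G p}.
- by move=> G p pG G' GG'; apply/Hyp/GG'.
- by move=> G p Tp G' _; apply: Ax.
- move=> G p q _ IH G' GG'; apply/ImpI/IH => s /= [->|/GG'];
  [by left|by right].
- by move=> G p q _ IH1 _ IH2 G' GG'; apply: ImpE (IH1 _ GG') (IH2 _ GG').
- move=> G p _ IH G' GG'; apply/Raa/IH => s /= [->|/GG'];
  [by left|by right].
- move=> G p _ IH G' GG'; apply/AllI/IH => s /List.in_map_iff[q [<- /GG' qG]].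
  exact: List.in_map.
- by move=> G p t _ IH G' GG'; apply/AllE/IH.
- by move=> *; apply: EqI.
- by move=> G p x y _ IH1 _ IH2 G' GG'; apply: EqE (IH1 _ GG') (IH2 _ GG').
Qed.

Lemma prv_iter_All N p : (forall G, prv T G p) -> forall G, prv T G (iter N All p).
Proof. by move=> pP; elim: N => //= N IH G; apply: AllI. Qed.

Lemma iter_AllE N p (r : nat -> nat) G : forall s,
  prv T G (ren s (iter N All p)) ->
  prv T G (ren (fun n => if n < N then r n else s (n - N)) p).
Proof.
elim: N => [|N IH] s pG /=.
  by congr (prv T G (ren _ p)): pG; apply: functional_extensionality => n;
     rewrite subn0.
have H : prv T G (inst (r N) (ren (up s) (iter N All p))) by apply: AllE.
have HE : inst (r N) (ren (up s) (iter N All p)) = ren (r N .: s) (iter N All p).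
  rewrite /inst ren_comp; congr (ren _ _).
  by apply: functional_extensionality => -[].
rewrite HE in H; move: (IH _ H).
congr (prv T G (ren _ p)); apply: functional_extensionality => n.
case: (ltngtP n N) => [nN|Nn|->]; first by rewrite ltnS ltnW.
  by rewrite ltnS leqNgt Nn /= subnS; case: (n - N) (subn_gt0 N n) => //; rewrite Nn.
by rewrite ltnSn subnn.
Qed.

(** The rule [Ax] yields only [p] itself. Quantifying over all variables below the bound of [p] and
    instantiating them along [r] gives the renamed axiom; the rule [AllI] does not restrict
    variables of axioms. *)
Lemma prv_Ax_ren p (r : nat -> nat) G : T p -> prv T G (ren r p).
Proof.
move=> Tp; have [N NP] := ren_bound p.
have /(iter_AllE r) : prv T G (ren (fun n => n) (iter N All p)).
  by rewrite ren_id; apply: prv_iter_All => G'; apply: Ax.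
by congr prv; apply: NP => n ->.
Qed.

Lemma map_ren_comp r r' G :
  map (ren r) (map (ren r') G) = map (ren (fun n => r (r' n))) G.
Proof. by rewrite -map_comp; apply: eq_map => p /=; rewrite ren_comp. Qed.

Lemma prv_ren G p : prv T G p -> forall r, prv T (map (ren r) G) (ren r p).
Proof.
elim=> {G p}.
- by move=> G p pG r; apply/Hyp/List.in_map.
- by move=> G p Tp r; apply: prv_Ax_ren.
- by move=> G p q _ IH r; apply/ImpI/IH.
- by move=> G p q _ IH1 _ IH2 r; apply: ImpE (IH1 r) (IH2 r).
- by move=> G p _ IH r; apply/Raa/IH.
- move=> G p _ IH r; apply: AllI; move: (IH (up r)).
  by rewrite !map_ren_comp.
- move=> G p t _ IH r; move: (AllE (r t) (IH r)); rewrite /inst !ren_comp.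
  by congr (prv T _ (ren _ p)); apply: functional_extensionality => -[].
- by move=> G x r; apply: EqI.
- move=> G p x y _ IH1 _ IH2 r.
  have instE t : ren r (inst t p) = inst (r t) (ren (up r) p).
    rewrite /inst !ren_comp.
    by congr (ren _ p); apply: functional_extensionality => -[].
  by rewrite instE; apply: EqE (IH1 r) _; rewrite -instE.
Qed.

(** Generalisation over a named fresh variable, whereas [AllI] shifts all indices. The renaming [r]
    moves [c] to 0 and every other variable up by one, so it acts on [G] as the shift and turns
    [inst c p] back into [p]. *)
Lemma prv_gen c G p : (forall q, List.In q G -> fresh c q) -> fresh c (All p) ->
  prv T G (inst c p) -> prv T G (All p).
Proof.
move=> cG cp Gp; apply: AllI.
pose r n := if n == c then 0 else n.+1.
have rS n : n <> c -> r n = n.+1 by move=> /eqP/negPf; rewrite /r => ->.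
have -> : map (ren succn) G = map (ren r) G.
  elim: G cG {Gp} => //= q G IH cG; rewrite IH => [|s sG].
    by congr cons; apply: cG => [|n nc]; [left | rewrite rS].
  by apply: cG; right.
suff <- : ren r (inst c p) = p by apply: prv_ren.
have [pE] : ren r (All p) = ren succn (All p) by apply: cp.
(* Lowering all indices undoes [up succn] on the right of [pE]; on the left it produces the renaming
   that has to fix [p]. *)
move: (congr1 (ren predn) pE); rewrite /inst !ren_comp.
have -> : (fun n => (up succn n).-1) = (fun n => n).
  by apply: functional_extensionality => -[].
rewrite ren_id => pE'; rewrite -[RHS]pE'; congr (ren _ p).
by apply: functional_extensionality => -[|n] //=; rewrite /r eqxx.
Qed.

End Deduction.

(** The encoding into generic trees makes formulas countable, so that the Henkin construction can
    run through all of them. *)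
Fixpoint form_tree (p : form) : GenTree.tree nat :=
  match p with
  | Bot => GenTree.Node 0 [::]
  | Mem x y => GenTree.Node 1 [:: GenTree.Leaf x; GenTree.Leaf y]
  | Eq x y => GenTree.Node 2 [:: GenTree.Leaf x; GenTree.Leaf y]
  | Imp p q => GenTree.Node 3 [:: form_tree p; form_tree q]
  | All p => GenTree.Node 4 [:: form_tree p]
  end.

Fixpoint tree_form (t : GenTree.tree nat) : form :=
  match t with
  | GenTree.Node 1 [:: GenTree.Leaf x; GenTree.Leaf y] => Mem x y
  | GenTree.Node 2 [:: GenTree.Leaf x; GenTree.Leaf y] => Eq x y
  | GenTree.Node 3 [:: t; u] => Imp (tree_form t) (tree_form u)
  | GenTree.Node 4 [:: t] => All (tree_form t)
  | _ => Bot
  end.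

Lemma form_treeK : cancel form_tree tree_form.
Proof. by elim=> //= [p -> q ->|p ->]. Qed.

Definition nth_form (n : nat) : form :=
  if unpickle n is Some t then tree_form t else Bot.

Lemma nth_form_surj p : exists n, nth_form n = p.
Proof. by exists (pickle (form_tree p)); rewrite /nth_form pickleK form_treeK. Qed.

Fixpoint sat {M : Type} (E : M -> M -> Prop) (e : nat -> M) (p : form) : Prop :=
  match p with
  | Bot => False
  | Mem x y => E (e x) (e y)
  | Eq x y => e x = e y
  | Imp p q => sat E e p -> sat E e q
  | All p => forall x, sat E (x .: e) p
  end.

(** * The Henkin construction of a term model *)

Section Henkin.
Context (T : form -> Prop) (phi : form).
Hypothesis phi_unprovable : ~ prv T [::] phi.

Definition consistent G := ~ prv T G Bot.

(** For a negated universal formula, a counterexample at a fresh variable is added. Variables play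
    the role of Henkin constants; a fresh one always exists because the stages are finite lists. *)
Definition witness (G : seq form) (q : form) : seq form :=
  if q is Imp (All p) Bot then
    [:: Not (inst (epsilon (inhabits 0)
                     (fun c => forall s, List.In s (q :: G) -> fresh c s)) p)]
  else [::].

Fixpoint stage (n : nat) : seq form :=
  if n is m.+1 then
    let q := nth_form m in
    if excluded_middle_informative (consistent (q :: stage m))
    then witness (stage m) q ++ q :: stage m else stage m
  else [:: Not phi].

(** If the counterexample at the fresh variable were refutable, [p] would be provable there, hence
    [All p] by [prv_gen], against the consistency of its negation. *)
Lemma witness_consistent G q : consistent (q :: G) -> consistent (witness G q ++ q :: G).
Proof.
case: q => // -[] // p [] //= qG /Raa pG; apply: qG.
set P := fun c => _ in pG.
have /(epsilon_spec (inhabits 0)) cP := fresh_seq (Imp (All p) Bot :: G).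
have cp : fresh (epsilon (inhabits 0) P) (Imp (All p) Bot) by apply: cP; left.
apply: (@ImpE _ _ (All p)); first by apply: Hyp; left.
apply: prv_gen pG; first exact: cP.
by move=> r r' rr'; case: (cp r r' rr') => /= ->.
Qed.

Lemma stage_consistent n : consistent (stage n).
Proof.
elim: n => /= [/Raa //|n IH].
by case: excluded_middle_informative => // ?; apply: witness_consistent.
Qed.

Lemma stage_sub m n p : m <= n -> List.In p (stage m) -> List.In p (stage n).
Proof.
elim: n => [|n IH]; first by rewrite leqn0 => /eqP->.
rewrite leq_eqVlt => /orP[/eqP-> //|/IH mn /mn pn] /=.
case: excluded_middle_informative => [?|//].
by apply/List.in_or_app; right; right.
Qed.

Definition thy p := exists n, prv T (stage n) p.

Lemma thy_imp p q : thy (Imp p q) -> thy p -> thy q.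
Proof.
move=> [n pq] [m pm]; exists (maxn n m).
by apply: ImpE (prv_weak pq _) (prv_weak pm _) => s; apply: stage_sub;
  rewrite leq_max leqnn ?orbT.
Qed.

Lemma thy_prv p : (forall G, prv T G p) -> thy p.
Proof. by exists 0. Qed.

Lemma thy_consistent : ~ thy Bot.
Proof. by move=> [n /stage_consistent]. Qed.

(** Take for [n] the index of [p] in the enumeration: at that stage [p] is either added together
    with its witness or already refuted. *)
Lemma stage_dec p : exists n,
  (forall q, List.In q (witness (stage n) p ++ p :: stage n) ->
             List.In q (stage n.+1))
  \/ prv T (stage n) (Not p).
Proof.
have [n np] := nth_form_surj p; exists n; rewrite /= np.
case: excluded_middle_informative => [?|pn]; first by left.
by right; apply: ImpI; apply: NNPP pn.
Qed.

Lemma thy_not p : ~ thy p -> thy (Not p).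
Proof.
have [n [np|np]] := stage_dec p => pn; last by exists n.
case: pn; exists n.+1; apply: Hyp; apply: np.
by apply/List.in_or_app; right; left.
Qed.

Lemma thy_Imp p q : thy (Imp p q) <-> (thy p -> thy q).
Proof.
split; first exact: thy_imp.
move=> pq; case: (classic (thy p)) => [/pq [n qn]|/thy_not [n pn]]; exists n.
  by apply: ImpI; apply: (prv_weak qn) => s; right.
apply: ImpI; apply: Raa; apply: (@ImpE _ _ p); last by apply: Hyp; right; left.
by apply: (prv_weak pn) => s; right; right.
Qed.

(** For the converse, if [Not (All p)] had been added, its witness would refute an instance that the
    theory proves; so [Not (All p)] is refuted at some stage. *)
Lemma thy_All p : thy (All p) <-> (forall t, thy (inst t p)).
Proof.
split=> [[n pn] t|ap]; first by exists n; apply: AllE.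
have [n [np|np]] := stage_dec (Not (All p)).
  case: thy_consistent; apply: thy_imp (ap _); exists n.+1.
  by apply: Hyp; apply: np; left.
exists n; apply: Raa; apply: ImpE (prv_weak np _) _ => [s|]; first by right.
by apply: Hyp; left.
Qed.

Lemma thy_eq_inst p x y : thy (Eq x y) -> thy (inst x p) -> thy (inst y p).
Proof.
move=> [n xy] [m xp]; exists (maxn n m).
by apply: EqE (prv_weak xy _) (prv_weak xp _) => s; apply: stage_sub;
  rewrite leq_max leqnn ?orbT.
Qed.

Lemma thy_eq_refl x : thy (Eq x x).
Proof. by apply: thy_prv => G; apply: EqI. Qed.

Lemma thy_eq_sym x y : thy (Eq x y) -> thy (Eq y x).
Proof.
move=> xy; apply: (@thy_eq_inst (Eq 0 x.+1) x y xy).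
exact: thy_eq_refl.
Qed.

Lemma thy_eq_trans x y z : thy (Eq x y) -> thy (Eq y z) -> thy (Eq x z).
Proof. by move=> xy yz; apply: (@thy_eq_inst (Eq x.+1 0) y z yz). Qed.

Lemma thy_mem x y x' y' :
  thy (Eq x x') -> thy (Eq y y') -> thy (Mem x y) -> thy (Mem x' y').
Proof.
move=> xx' yy' xy; apply: (@thy_eq_inst (Mem x'.+1 0) y y' yy').
exact: (@thy_eq_inst (Mem 0 y.+1) x x' xx').
Qed.

(** Classes of variables under provable equality, represented as predicates: [sat] reads [Eq] as
    equality of elements, so provably equal variables have to become the same element. *)
Definition term := {P : nat -> Prop | exists n, P = fun m => thy (Eq n m)}.

Definition cls (n : nat) : term :=
  exist _ (fun m => thy (Eq n m)) (ex_intro _ n erefl).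

Lemma cls_surj (x : term) : exists n, x = cls n.
Proof.
case: x => P [n Pn]; exists n; rewrite /cls; subst P.
by congr exist; apply: proof_irrelevance.
Qed.

Lemma cls_eq x y : cls x = cls y <-> thy (Eq x y).
Proof.
split=> [[]|xy].
  by move=> /(congr1 (fun P => P y)) ->; apply: thy_eq_refl.
have PE : (fun m => thy (Eq x m)) = (fun m => thy (Eq y m)).
  apply: functional_extensionality => m; apply: propositional_extensionality.
  by split; apply: thy_eq_trans => //; apply: thy_eq_sym.
rewrite /cls; move: (ex_intro _ _ _) (ex_intro _ _ _); rewrite PE => a b.
by congr exist; apply: proof_irrelevance.
Qed.

Definition term_mem (x y : term) :=
  exists m n, [/\ x = cls m, y = cls n & thy (Mem m n)].

(** The renaming [r] is kept general because the quantifier case extends it by an arbitrary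
    representative. *)
Lemma truth p : forall r, sat term_mem (fun n => cls (r n)) p <-> thy (ren r p).
Proof.
elim: p => [|x y|x y|p IHp q IHq|p IHp] r /=.
- by split=> // /thy_consistent.
- split=> [[m [n [/cls_eq xm /cls_eq yn mn]]]|xy]; last by exists (r x), (r y).
  by apply: thy_mem mn; apply: thy_eq_sym.
- exact: cls_eq.
- by rewrite thy_Imp -IHp -IHq.
- have H t : sat term_mem (cls t .: fun n => cls (r n)) p <->
             thy (inst t (ren (up r) p)).
    have -> : inst t (ren (up r) p) = ren (t .: r) p.
      rewrite /inst ren_comp; congr (ren _ p).
      by apply: functional_extensionality => -[].
    rewrite -IHp; suff -> : (cls t .: fun n => cls (r n)) =
                            (fun n => cls ((t .: r) n)) by [].
    by apply: functional_extensionality => -[].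
  rewrite thy_All; split=> [ap t|ap x]; first exact/H.
  by have [t ->] := cls_surj x; apply/H.
Qed.

Lemma henkin_model : exists (M : Type) (E : M -> M -> Prop),
  (forall p e, T p -> sat E e p) /\ exists e, ~ sat E e phi.
Proof.
exists term, term_mem; split=> [p e Tp|].
  (* Choosing representatives turns any environment into a renaming, and the theory contains all
     renamings of the axioms. *)
  have [r ->] : exists r, e = fun n => cls (r n).
    exists (fun n => epsilon (inhabits 0) (fun m => e n = cls m)).
    apply: functional_extensionality => n.
    exact: (epsilon_spec (inhabits 0) _ (cls_surj (e n))).
  by apply/truth/thy_prv => G; apply: prv_Ax_ren.
exists cls => /(truth phi (fun n => n)); rewrite ren_id => phiT.
apply: thy_consistent; apply: thy_imp phiT; exists 0.
by apply: Hyp; left.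
Qed.

End Henkin.

Theorem completeness (T : form -> Prop) (phi : form) :
  (forall (M : Type) (E : M -> M -> Prop), (forall p e, T p -> sat E e p) ->
     forall e, sat E e phi) ->
  prv T [::] phi.
Proof.
move=> valid; apply: NNPP => /henkin_model [M [E [ax [e []]]]].
exact: valid.
Qed.

(** * Models of ZF and definability *)

Lemma sat_ren M (E : M -> M -> Prop) p :
  forall r e, sat E e (ren r p) <-> sat E (fun n => e (r n)) p.
Proof.
elim: p => //= [p IHp q IHq|p IHp] r e; first by rewrite IHp IHq.
have H x : sat E (x .: e) (ren (up r) p) <-> sat E (x .: fun n => e (r n)) p.
  rewrite IHp; suff -> : (fun n => (x .: e) (up r n)) = (x .: fun n => e (r n)) by [].
  by apply: functional_extensionality => -[].
by split=> sp x; apply/H.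
Qed.

(** The field [point] supplies default values and default environments. *)
Structure zf_model : Type := ZFModel {
  carrier :> Type;
  member : carrier -> carrier -> Prop;
  point : carrier;
  zf_sat : forall p e, ZF p -> sat member e p
}.
Arguments member {_} _ _.

Declare Scope model_scope.
Local Notation "x ∈ y" := (member x y) (at level 50, no associativity) : model_scope.
Local Notation "x ∉ y" := (~ member x y) (at level 50, no associativity) : model_scope.
Local Open Scope model_scope.

Section Definability.
Context {M : zf_model}.

Definition lookup (v : nat -> M) (t : nat + M) : M :=
  match t with inl i => v i | inr c => c end.

(* [s] assigns to each free variable of [p] an entry of the environment or a
   parameter. *)
Definition def (P : (nat -> M) -> Prop) : Prop :=
  exists p (s : nat -> nat + M),
    forall v, P v <-> sat member (fun n => lookup v (s n)) p.

(* The graph of [t] is definable; entry 0 of the environment holds the value. *)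
Definition dterm (t : (nat -> M) -> M) : Prop :=
  def (fun v => t (fun n => v n.+1) = v 0).

Lemma def_ext (P Q : (nat -> M) -> Prop) :
  def P -> (forall v, P v <-> Q v) -> def Q.
Proof. by move=> [p [s ps]] PQ; exists p, s => v; rewrite -PQ. Qed.

Lemma def_subst P (s : nat -> nat + M) :
  def P -> def (fun v => P (fun n => lookup v (s n))).
Proof.
move=> [p [r pr]].
exists p, (fun n => match r n with inl i => s i | inr c => inr c end) => v.
rewrite pr; suff -> : (fun n => lookup (fun n => lookup v (s n)) (r n)) =
  (fun n => lookup v match r n with inl i => s i | inr c => inr c end) by [].
by apply: functional_extensionality => n; case: (r n).
Qed.

Lemma def_ren P (r : nat -> nat) : def P -> def (fun v => P (fun n => v (r n))).
Proof. by move=> dP; apply: (def_subst (fun n => inl (r n)) dP). Qed.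

Lemma def_False : def (fun _ => False).
Proof. by exists Bot, (fun n => inl n). Qed.

Lemma def_imp P Q : def P -> def Q -> def (fun v => P v -> Q v).
Proof.
move=> [p [s ps]] [q [t qt]].
(* The variables of the two formulas are kept apart by using even indices for [p] and odd ones for
   [q]. *)
exists (Imp (ren double p) (ren (fun n => n.*2.+1) q)).
exists (fun n => if odd n then t n./2 else s n./2) => v /=.
rewrite !sat_ren ps qt.
have -> : (fun n => lookup v (if odd n.*2 then t n.*2./2 else s n.*2./2)) =
          (fun n => lookup v (s n)).
  by apply: functional_extensionality => n; rewrite odd_double doubleK.
have -> // : (fun n => lookup v (if odd n.*2.+1 then t n.*2.+1./2 else s n.*2.+1./2))
          = (fun n => lookup v (t n)).
by apply: functional_extensionality => n;
  rewrite oddS odd_double /= uphalf_double.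
Qed.

(** Normal form in which index 0 alone refers to the head of the environment, the shape expected by
    [All] and by the separation scheme. Other indices that [s] had mapped to the head are redirected
    to 0. *)
Lemma def_cons (P : (nat -> M) -> Prop) : def P -> exists p s,
  forall v x, P (x .: v) <-> sat member (x .: fun n => lookup v (s n)) p.
Proof.
move=> [p [s ps]].
exists (ren (fun n => if s n is inl 0 then 0 else n.+1) p).
exists (fun n => if s n is inl i.+1 then inl i else s n) => v x.
rewrite ps sat_ren.
suff -> : (fun n => lookup (x .: v) (s n)) =
  (fun n => (x .: fun n => lookup v (if s n is inl i.+1 then inl i else s n))
     (if s n is inl 0 then 0 else n.+1)) by [].
by apply: functional_extensionality => n; case sn: (s n) => [[|i]|c] /=; rewrite ?sn.
Qed.

Lemma def_cons2 (P : (nat -> M) -> Prop) : def P -> exists p s,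
  forall v x y,
  P (x .: y .: v) <-> sat member (x .: y .: fun n => lookup v (s n)) p.
Proof.
move=> /def_cons[p [s ps]].
exists (ren (up (fun n => if s n is inl 0 then 0 else n.+1)) p).
exists (fun n => if s n is inl i.+1 then inl i else s n) => v x y.
rewrite ps sat_ren.
suff -> : (x .: fun n => lookup (y .: v) (s n)) =
  (fun n => (x .: y .: fun n => lookup v (if s n is inl i.+1 then inl i else s n))
     (up (fun n => if s n is inl 0 then 0 else n.+1) n)) by [].
by apply: functional_extensionality => -[|n] //=;
  case sn: (s n) => [[|i]|c] /=; rewrite ?sn.
Qed.

Lemma def_all (Q : (nat -> M) -> M -> Prop) :
  def (fun v => Q (fun n => v n.+1) (v 0)) -> def (fun v => forall x, Q v x).
Proof.
move=> /def_cons[p [s ps]]; exists (All p), s => v.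
by split=> Qv x; apply/ps; apply: Qv.
Qed.

Lemma def_not P : def P -> def (fun v => ~ P v).
Proof. by move=> dP; apply: def_imp dP def_False. Qed.

(** Here [P] is any proposition of the metatheory: it is decided classically and represented by
    [Bot] or its negation. *)
Lemma def_const (P : Prop) : def (fun _ => P).
Proof.
case: (classic P) => p; last by apply: (def_ext def_False).
by apply: (def_ext (def_not def_False)) => v; tauto.
Qed.

Lemma def_and P Q : def P -> def Q -> def (fun v => P v /\ Q v).
Proof.
move=> dP dQ; apply: (def_ext (def_not (def_imp dP (def_not dQ)))) => v; tauto.
Qed.

Lemma def_or P Q : def P -> def Q -> def (fun v => P v \/ Q v).
Proof.
move=> dP dQ; apply: (def_ext (def_imp (def_not dP) dQ)) => v; tauto.
Qed.

Lemma def_iff P Q : def P -> def Q -> def (fun v => P v <-> Q v).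
Proof. by move=> dP dQ; apply: def_and; apply: def_imp. Qed.

Lemma def_and3 P Q R : def P -> def Q -> def R -> def (fun v => [/\ P v, Q v & R v]).
Proof.
move=> dP dQ dR; apply: (def_ext (def_and dP (def_and dQ dR))) => v.
by split=> [[? []]|[]].
Qed.

Lemma def_or3 P Q R : def P -> def Q -> def R -> def (fun v => [\/ P v, Q v | R v]).
Proof.
move=> dP dQ dR; apply: (def_ext (def_or dP (def_or dQ dR))) => v.
by split=> [[?|[?|?]]|[]];
  [constructor 1|constructor 2|constructor 3|left|right; left|right; right].
Qed.

Lemma def_ex (Q : (nat -> M) -> M -> Prop) :
  def (fun v => Q (fun n => v n.+1) (v 0)) -> def (fun v => exists x, Q v x).
Proof.
move=> dQ.
apply: (def_ext (def_not (@def_all (fun v x => ~ Q v x) (def_not dQ)))) => v.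
by split=> [/not_all_ex_not[x /NNPP]|[x Qx] nQ]; [exists x | apply: (nQ x)].
Qed.

(** The language has no function symbols, so a definable term is substituted by quantifying over its
    value. *)
Lemma def_comp (P : (nat -> M) -> M -> Prop) t :
  def (fun v => P (fun n => v n.+1) (v 0)) -> dterm t -> def (fun v => P v (t v)).
Proof.
move=> dP dt.
apply: (def_ext (@def_ex (fun v x => t v = x /\ P v x) (def_and dt dP))) => v.
by split=> [[x [-> ?]]|Ptv]; [|exists (t v)].
Qed.

Lemma def_comp2 (P : (nat -> M) -> M -> M -> Prop) t u :
  def (fun v => P (fun n => v n.+2) (v 0) (v 1)) -> dterm t -> dterm u ->
  def (fun v => P v (t v) (u v)).
Proof.
move=> dP dt du; apply: (@def_comp (fun v y => P v (t v) y)) => //.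
apply: (@def_comp (fun v x => P (fun n => v n.+1) x (v 0))
  (fun v => t (fun n => v n.+1))) => //.
exact: (def_ren (fun n => if n is m.+1 then m.+2 else 0) dt).
Qed.

Lemma dterm_var i : dterm (fun v => v i).
Proof.
by exists (Eq 0 1), (fun n => if n is 0 then inl i.+1 else inl 0).
Qed.

Lemma dterm_const c : dterm (fun _ => c).
Proof. by exists (Eq 0 1), (fun n => if n is 0 then inr c else inl 0). Qed.

Lemma def_mem t u : dterm t -> dterm u -> def (fun v => t v ∈ u v).
Proof.
apply: (@def_comp2 (fun _ x y => x ∈ y)).
by exists (Mem 0 1), (fun n => inl n).
Qed.

Lemma def_eq t u : dterm t -> dterm u -> def (fun v => t v = u v).
Proof.
apply: (@def_comp2 (fun _ x y => x = y)).
by exists (Eq 0 1), (fun n => inl n).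
Qed.

Lemma dterm_comp (F : M -> M) t :
  dterm (fun v => F (v 0)) -> dterm t -> dterm (fun v => F (t v)).
Proof.
move=> dF dt; apply: (@def_comp (fun v y => F y = v 0) (fun v => t (fun n => v n.+1))).
  exact: (def_ren (fun n => if n is 0 then 1 else 0) dF).
exact: (def_ren (fun n => if n is m.+1 then m.+2 else 0) dt).
Qed.

Lemma dterm_comp2 (F : M -> M -> M) t u :
  dterm (fun v => F (v 0) (v 1)) -> dterm t -> dterm u ->
  dterm (fun v => F (t v) (u v)).
Proof.
move=> dF dt du.
apply: (@def_comp2 (fun v x y => F x y = v 0) (fun v => t (fun n => v n.+1))
  (fun v => u (fun n => v n.+1))).
- exact: (def_ren (fun n => match n with 0 => 2 | 1 => 0 | _ => 1 end) dF).
- exact: (def_ren (fun n => if n is m.+1 then m.+2 else 0) dt).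
- exact: (def_ren (fun n => if n is m.+1 then m.+2 else 0) du).
Qed.

Lemma def_inst (Q : (nat -> M) -> M -> Prop) w :
  def (fun v => Q (fun n => v n.+1) (v 0)) -> def (fun v => Q w (v 0)).
Proof.
move=> dQ; exact: (def_subst (fun n => if n is m.+1 then inr (w m) else inl 0) dQ).
Qed.

Lemma def_inst2 (Q : (nat -> M) -> M -> M -> Prop) w :
  def (fun v => Q (fun n => v n.+2) (v 0) (v 1)) -> def (fun v => Q w (v 0) (v 1)).
Proof.
move=> dQ; exact: (def_subst
  (fun n => match n with 0 => inl 0 | 1 => inl 1 | m.+2 => inr (w m) end) dQ).
Qed.

End Definability.

Create HintDb def discriminated.
#[local] Hint Constants Opaque : def.
#[local] Hint Variables Opaque : def.
#[local] Hint Resolve def_imp def_and def_and3 def_or def_or3 def_not def_iff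
  def_all def_ex def_mem def_eq dterm_var : def.
#[local] Hint Resolve def_const dterm_const | 0 : def.
(** Definability is proved by recursion on the shape of the predicate. *)
Ltac solve_def := solve [typeclasses eauto with def].

(** * Reading formulas as predicates on a model *)

Definition sem {M : zf_model} (p : form) (P : (nat -> M) -> Prop) :=
  forall e, sat member e p <-> P e.

Section Semantics.
Context {M : zf_model}.
Implicit Types P Q : (nat -> M) -> Prop.

Lemma sem_ext p P Q : sem p P -> (forall e, P e <-> Q e) -> sem p Q.
Proof. by move=> pP PQ e; rewrite pP. Qed.

Lemma sem_Bot : sem Bot (fun _ : nat -> M => False).
Proof. by []. Qed.

Lemma sem_Mem x y : sem (Mem x y) (fun e : nat -> M => e x ∈ e y).
Proof. by []. Qed.

Lemma sem_Eq x y : sem (Eq x y) (fun e : nat -> M => e x = e y).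
Proof. by []. Qed.

Lemma sem_Imp p q P Q : sem p P -> sem q Q -> sem (Imp p q) (fun e => P e -> Q e).
Proof. move=> pP qQ e; move: (pP e) (qQ e) => /=; tauto. Qed.

Lemma sem_Not p P : sem p P -> sem (Not p) (fun e => ~ P e).
Proof. move=> pP e; move: (pP e) => /=; tauto. Qed.

Lemma sem_And p q P Q : sem p P -> sem q Q -> sem (And p q) (fun e => P e /\ Q e).
Proof. move=> pP qQ e; move: (pP e) (qQ e) => /=; tauto. Qed.

Lemma sem_Or p q P Q : sem p P -> sem q Q -> sem (Or p q) (fun e => P e \/ Q e).
Proof. move=> pP qQ e; move: (pP e) (qQ e) => /=; tauto. Qed.

Lemma sem_Iff p q P Q : sem p P -> sem q Q -> sem (Iff p q) (fun e => P e <-> Q e).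
Proof. by move=> pP qQ; apply: sem_And; apply: sem_Imp. Qed.

Lemma sem_All p P : sem p P -> sem (All p) (fun e => forall x, P (x .: e)).
Proof. by move=> pP e; split=> /= H x; apply/pP; apply: H. Qed.

Lemma sem_Ex p P : sem p P -> sem (Ex p) (fun e => exists x, P (x .: e)).
Proof.
move=> pP e; split=> /=; last by move=> [x /pP px] H; exact: (H x px).
by move=> np; apply: NNPP => nP; apply: np => x /pP px; apply: nP; exists x.
Qed.

Lemma sem_ren r p P : sem p P -> sem (ren r p) (fun e => P (fun n => e (r n))).
Proof. by move=> pP e; rewrite sat_ren. Qed.

Lemma def_sem p P : sem p P -> def P.
Proof. by move=> pP; exists p, (fun n => inl n) => v; rewrite -pP. Qed.

End Semantics.

Create HintDb sem discriminated.
#[local] Hint Constants Opaque : sem.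
#[local] Hint Variables Opaque : sem.
#[local] Hint Resolve sem_Bot sem_Mem sem_Eq sem_Imp sem_Not sem_And sem_Or sem_Iff
  sem_All sem_Ex sem_ren : sem.
(** Proof search computes from the syntax of a formula the predicate it expresses; what remains is
    to compare this with the intended one. *)
Ltac solve_sem := eapply sem_ext; [solve [typeclasses eauto with sem] | cbn [scons]].

(** * Set operations *)

Section DefinableOperations.
Context {M : zf_model}.

Definition drel1 (P : M -> Prop) := def (fun v => P (v 0)).
Definition drel2 (R : M -> M -> Prop) := def (fun v => R (v 0) (v 1)).
Definition dfun1 (F : M -> M) := dterm (fun v => F (v 0)).
Definition dfun2 (F : M -> M -> M) := dterm (fun v => F (v 0) (v 1)).

Lemma def_rel1 (P : M -> Prop) t : drel1 P -> dterm t -> def (fun v => P (t v)).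
Proof. exact: (@def_comp _ (fun _ => P)). Qed.

Lemma def_rel2 (R : M -> M -> Prop) t u :
  drel2 R -> dterm t -> dterm u -> def (fun v => R (t v) (u v)).
Proof. exact: (@def_comp2 _ (fun _ => R)). Qed.

Lemma dterm_fun1 (F : M -> M) t : dfun1 F -> dterm t -> dterm (fun v => F (t v)).
Proof. exact: dterm_comp. Qed.

Lemma dterm_fun2 (F : M -> M -> M) t u :
  dfun2 F -> dterm t -> dterm u -> dterm (fun v => F (t v) (u v)).
Proof. exact: dterm_comp2. Qed.

End DefinableOperations.

#[local] Hint Extern 1 (def _) => match goal with
  | H : drel1 ?P |- def (fun v => ?P (@?t v)) => simple apply (@def_rel1 _ P t H)
  | H : drel2 ?R |- def (fun v => ?R (@?t v) (@?u v)) =>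
      simple apply (@def_rel2 _ R t u H)
  end : def.
#[local] Hint Extern 1 (dterm _) => match goal with
  | H : dfun1 ?F |- dterm (fun v => ?F (@?t v)) => simple apply (@dterm_fun1 _ F t H)
  | H : dfun2 ?F |- dterm (fun v => ?F (@?t v) (@?u v)) =>
      simple apply (@dterm_fun2 _ F t u H)
  end : def.
#[local] Hint Extern 0 (drel1 _) => unfold drel1 : def.
#[local] Hint Extern 0 (drel2 _) => unfold drel2 : def.
#[local] Hint Extern 0 (dfun1 _) => unfold dfun1 : def.
#[local] Hint Extern 0 (dfun2 _) => unfold dfun2 : def.

Local Notation "x ⊆ y" := (forall z, z ∈ x -> z ∈ y)
  (at level 50, no associativity) : model_scope.

Lemma zf_sem {M : zf_model} p (P : (nat -> M) -> Prop) : ZF p -> sem p P -> forall e, P e.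
Proof. by move=> /(@zf_sat M p) ps pP e; apply/pP. Qed.

Ltac zf_ax ax := lazymatch goal with M : zf_model |- _ =>
  have := @zf_sem M _ _ ax ltac:(typeclasses eauto with sem); cbn [scons] end.

Section SetOperations.
Context {M : zf_model}.

Lemma sem_Sub x y : sem (Sub x y) (fun e : nat -> M => e x ⊆ e y).
Proof. by rewrite /Sub; solve_sem. Qed.

Lemma sem_Empty x : sem (Empty x) (fun e : nat -> M => forall y, y ∉ e x).
Proof. by rewrite /Empty; solve_sem. Qed.

Lemma sem_Disjoint x y :
  sem (Disjoint x y) (fun e : nat -> M => forall z, ~ (z ∈ e x /\ z ∈ e y)).
Proof. by rewrite /Disjoint; solve_sem. Qed.

Lemma sem_Union x y : sem (Union x y)
  (fun e : nat -> M => forall z, z ∈ e x <-> exists w, w ∈ e y /\ z ∈ w).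
Proof. by rewrite /Union; solve_sem. Qed.

Lemma sem_Upair z x y : sem (Upair z x y)
  (fun e : nat -> M => forall w, w ∈ e z <-> w = e x \/ w = e y).
Proof. by rewrite /Upair; solve_sem. Qed.

Lemma sem_Succ y x : sem (Succ y x)
  (fun e : nat -> M => forall z, z ∈ e y <-> z ∈ e x \/ z = e x).
Proof. by rewrite /Succ; solve_sem. Qed.

#[local] Hint Resolve sem_Sub sem_Empty sem_Disjoint sem_Union sem_Upair sem_Succ : sem.

Implicit Types (x y z a b f : M).

Let e0 (n : nat) : M := point M.

Lemma set_ext x y : (forall z, z ∈ x <-> z ∈ y) -> x = y.
Proof. by move=> xy; zf_ax Extensionality => /(_ e0 y x); apply. Qed.

(* Junk value when [P] is not the extension of a set. *)
Definition setof (P : M -> Prop) : M :=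
  epsilon (inhabits (point M)) (fun y => forall z, z ∈ y <-> P z).

(** Stated as an equation between propositions, so that membership can be rewritten. *)
Lemma in_setof P : (exists y : M, forall z, z ∈ y <-> P z) ->
  forall z, (z ∈ setof P) = P z.
Proof.
move=> /(epsilon_spec (inhabits (point M))) yP z.
exact: propositional_extensionality.
Qed.

(** By extensionality, the value is pinned down by the definable condition that its elements are
    those satisfying [Q]. *)
Lemma dterm_setof (Q : (nat -> M) -> M -> Prop) :
  def (fun v => Q (fun n => v n.+1) (v 0)) ->
  (forall v, exists y, forall z, z ∈ y <-> Q v z) ->
  dterm (fun v => setof (Q v)).
Proof.
move=> dQ setQ.
have dQ' : def (fun v => Q (fun n => v n.+2) (v 0)).
  exact: (def_ren (fun n => if n is m.+1 then m.+2 else 0) dQ).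
have : def (fun v => forall z, z ∈ v 0 <-> Q (fun n => v n.+1) z).
  by solve_def.
move/def_ext; apply=> v; have QE := in_setof (setQ (fun n => v n.+1)).
split=> [vQ|<- z]; last by rewrite QE.
by apply: set_ext => z; rewrite QE vQ.
Qed.

Lemma separation (P : M -> Prop) a :
  def (fun v => P (v 0)) -> exists y, forall z, z ∈ y <-> z ∈ a /\ P z.
Proof.
move=> /def_cons [p [s ps]].
have semp : sem p (sat member^~ p) by [].
(* The scheme reserves index 1 for the ambient set, so the parameters of [p] are moved past it. *)
zf_ax (Separation (ren (up succn) p)).
move=> /(_ (fun n => lookup e0 (s n)) a)[y yP]; exists y => z; rewrite yP.
have -> : (fun n => (z .: y .: a .: fun n => lookup e0 (s n)) (up succn (up succn n)))
  = (z .: fun n => lookup e0 (s n)) by apply: functional_extensionality => -[|n].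
by rewrite -ps.
Qed.

Lemma replacement (R : M -> M -> Prop) a :
  def (fun v => R (v 0) (v 1)) -> (forall x y y', R x y -> R x y' -> y = y') ->
  exists b, forall y, y ∈ b <-> exists x, x ∈ a /\ R x y.
Proof.
move=> dR funR.
(* The scheme expects the value at index 0 and the argument at index 1, hence the swap. *)
have /def_cons2[p [s ps]] : def (fun v : nat -> M => R (v 1) (v 0)).
  exact: (def_ren (fun n => if n is 0 then 1 else 0) dR).
have semp : sem p (sat member^~ p) by [].
have {}ps x y : sat member (y .: x .: fun n => lookup e0 (s n)) p <-> R x y.
  by rewrite -ps.
zf_ax (Replacement p) => /(_ (fun n => lookup e0 (s n))) H.
case: (H _ a) => [x y y' [/ps xy]|c cP] {H}.
  have -> : (fun n => (y' .: y .: x .: fun n => lookup e0 (s n)) (up succn n)) =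
    (y' .: x .: fun n => lookup e0 (s n)) by apply: functional_extensionality => -[|[]].
  by move=> /ps; apply: funR xy.
exists c => y; rewrite cP.
have E x : (fun n => (x .: y .: c .: a .: fun n => lookup e0 (s n))
    match n with 0 => 1 | 1 => 0 | m.+2 => m.+4 end) =
    (y .: x .: fun n => lookup e0 (s n)) by apply: functional_extensionality => -[|[]].
by split=> -[x [xa xy]]; exists x; split=> //; move: xy; rewrite E ps.
Qed.

Definition empty : M := setof (fun _ => False).
Definition pair x y : M := setof (fun z => z = x \/ z = y).
Definition bigcup x : M := setof (fun z => exists w, w ∈ x /\ z ∈ w).
Definition pow x : M := setof (fun z => z ⊆ x).
Definition sep (P : M -> Prop) x : M := setof (fun z => z ∈ x /\ P z).
Definition img (F : M -> M) x : M := setof (fun y => exists z, z ∈ x /\ y = F z).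
(* [empty] unless [P] holds of exactly one set. *)
Definition the (P : M -> Prop) : M :=
  setof (fun z => exists y, (P y /\ forall y', P y' -> y' = y) /\ z ∈ y).

Lemma in_empty x : x ∈ empty = False.
Proof.
apply: in_setof; have [y yP] := separation (P := fun _ => False) (point M) (def_const False).
by exists y => z; rewrite yP; split=> // -[].
Qed.

Lemma in_pair x y z : z ∈ pair x y = (z = x \/ z = y).
Proof. by apply: in_setof; zf_ax Pairing => /(_ e0 y x). Qed.

Lemma in_bigcup x z : z ∈ bigcup x = exists w, w ∈ x /\ z ∈ w.
Proof. by apply: in_setof; zf_ax Unions => /(_ e0 x). Qed.

Lemma in_pow x z : z ∈ pow x = (z ⊆ x).
Proof. by apply: in_setof; zf_ax Powerset => /(_ e0 x). Qed.

Lemma in_sep (P : M -> Prop) : drel1 P -> forall x z, z ∈ sep P x = (z ∈ x /\ P z).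
Proof. by move=> dP x; apply: in_setof; apply: separation. Qed.

Lemma img_set (F : M -> M) x : dfun1 F ->
  exists y, forall z, z ∈ y <-> exists w, w ∈ x /\ z = F w.
Proof.
move=> dF; apply: (@replacement (fun z w => w = F z)); last by move=> ? ? ? ->.
by solve_def.
Qed.

Lemma in_img (F : M -> M) : dfun1 F ->
  forall x y, y ∈ img F x = exists z, z ∈ x /\ y = F z.
Proof. by move=> dF x; apply: in_setof; apply/img_set. Qed.

Lemma theP (P : M -> Prop) x : P x -> (forall y, P y -> y = x) -> the P = x.
Proof.
move=> Px xP; have setx : forall z, z ∈ x <->
    exists y, (P y /\ forall y', P y' -> y' = y) /\ z ∈ y.
  move=> z; split=> [zx|[y [[/xP -> _]]] //].
  by exists x.
apply: set_ext => z; rewrite in_setof; last by exists x.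
by rewrite -setx.
Qed.

Lemma the_spec (P : M -> Prop) : (exists x, P x /\ forall y, P y -> y = x) -> P (the P).
Proof. by move=> [x [Px xP]]; rewrite (theP Px xP). Qed.

Lemma dterm_pair t u : dterm t -> dterm u -> dterm (fun v => pair (t v) (u v)).
Proof.
apply: dterm_comp2; apply: dterm_setof => [|v]; first by solve_def.
by exists (pair (v 0) (v 1)) => z; rewrite in_pair.
Qed.

Lemma dterm_bigcup t : dterm t -> dterm (fun v => bigcup (t v)).
Proof.
apply: dterm_comp; apply: dterm_setof => [|v]; first by solve_def.
by exists (bigcup (v 0)) => z; rewrite in_bigcup.
Qed.

Lemma dterm_pow t : dterm t -> dterm (fun v => pow (t v)).
Proof.
apply: dterm_comp; apply: dterm_setof => [|v]; first by solve_def.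
by exists (pow (v 0)) => z; rewrite in_pow.
Qed.

Lemma dterm_sep (Q : (nat -> M) -> M -> Prop) t :
  def (fun v => Q (fun n => v n.+1) (v 0)) -> dterm t -> dterm (fun v => sep (Q v) (t v)).
Proof.
move=> dQ dt; apply: dterm_setof => [|v]; last exact: separation (def_inst v dQ).
apply: def_and => //; apply: def_mem; first exact: dterm_var.
exact: (def_ren (fun n => if n is m.+1 then m.+2 else 0) dt).
Qed.

Lemma dterm_img (F : (nat -> M) -> M -> M) t :
  dterm (fun v => F (fun n => v n.+1) (v 0)) -> dterm t -> dterm (fun v => img (F v) (t v)).
Proof.
move=> dF dt; apply: dterm_setof => [|v]; last first.
  by apply: img_set; exact: (def_inst2 (Q := fun v y x => F v x = y) v dF).
apply: (@def_ex _ (fun v w => w ∈ t (fun n => v n.+1) /\ v 0 = F (fun n => v n.+1) w)).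
apply: def_and.
  apply: def_mem; first exact: dterm_var.
  exact: (def_ren (fun n => if n is m.+1 then m.+3 else 0) dt).
apply: def_ext; first exact: (def_ren (fun n => match n with 0 => 1 | 1 => 0 | m => m end) dF).
by move=> v; split=> /esym.
Qed.

Lemma dterm_the (Q : (nat -> M) -> M -> Prop) :
  def (fun v => Q (fun n => v n.+1) (v 0)) -> dterm (fun v => the (Q v)).
Proof.
move=> dQ; apply: dterm_setof => [|v]; last first.
  have [[y yP]|nP] := classic (exists y, Q v y /\ forall y', Q v y' -> y' = y).
    exists y => z; split=> [zy|[x [xP]]]; first by exists y.
    by case: yP => _ /(_ x) -> //; case: xP.
  by exists empty => z; rewrite in_empty; split=> // -[y [yP _]]; apply: nP; exists y.
have d1 : def (fun v => Q (fun n => v n.+3) (v 0)).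
  exact: (def_ren (fun n => if n is m.+1 then m.+3 else 0) dQ).
have d2 : def (fun v => Q (fun n => v n.+2) (v 0)).
  exact: (def_ren (fun n => if n is m.+1 then m.+2 else 0) dQ).
solve_def.
Qed.

(** Foundation applied to the subset of [a] cut out by [P]; used below as a principle of minimal
    elements. *)
Lemma foundation (P : M -> Prop) a : drel1 P -> (exists2 x, x ∈ a & P x) ->
  exists x, [/\ x ∈ a, P x & forall y, y ∈ x -> y ∈ a -> ~ P y].
Proof.
move=> dP [x xa Px]; zf_ax Foundation.
move=> /(_ (fun _ => a) (sep P a)) []; first by move=> /(_ x); rewrite in_sep // => H; apply: H.
move=> y []; rewrite in_sep // => -[ya Py] yP; exists y; split=> // z zy za Pz.
by apply: (yP z); rewrite in_sep.
Qed.

End SetOperations.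

#[local] Hint Resolve dterm_pair dterm_bigcup dterm_pow dterm_sep dterm_img dterm_the : def.
Arguments empty {M}.

(** * Pairs, functions and natural numbers *)

Section DerivedOperations.
Context {M : zf_model}.
Implicit Types (x y z a b f : M).

Definition opair x y : M := pair (pair x x) (pair x y).
Definition cup x y : M := bigcup (pair x y).
Definition cap x y : M := sep (fun z => z ∈ y) x.
Definition diff x y : M := sep (fun z => z ∉ y) x.
Definition adj x a : M := cup x (pair a a).
Definition del x a : M := sep (fun z => z <> a) x.
Definition prod x y : M := bigcup (img (fun a => img (opair a) y) x).

Lemma dterm_opair t u : dterm t -> dterm u -> dterm (fun v => opair (t v) (u v)).
Proof. by apply: dterm_fun2; rewrite /dfun2 /opair; solve_def. Qed.

Lemma dterm_cup t u : dterm t -> dterm u -> dterm (fun v => cup (t v) (u v)).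
Proof. by apply: dterm_fun2; rewrite /dfun2 /cup; solve_def. Qed.

Lemma dterm_cap t u : dterm t -> dterm u -> dterm (fun v => cap (t v) (u v)).
Proof. by apply: dterm_fun2; rewrite /dfun2 /cap; solve_def. Qed.

Lemma dterm_diff t u : dterm t -> dterm u -> dterm (fun v => diff (t v) (u v)).
Proof. by apply: dterm_fun2; rewrite /dfun2 /diff; solve_def. Qed.

Lemma dterm_del t u : dterm t -> dterm u -> dterm (fun v => del (t v) (u v)).
Proof. by apply: dterm_fun2; rewrite /dfun2 /del; solve_def. Qed.

#[local] Hint Resolve dterm_opair dterm_cup dterm_cap dterm_diff dterm_del : def.

Lemma dterm_adj t u : dterm t -> dterm u -> dterm (fun v => adj (t v) (u v)).
Proof. by apply: dterm_fun2; rewrite /dfun2 /adj; solve_def. Qed.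

Lemma dterm_prod t u : dterm t -> dterm u -> dterm (fun v => prod (t v) (u v)).
Proof. by apply: dterm_fun2; rewrite /dfun2 /prod; solve_def. Qed.

#[local] Hint Resolve dterm_adj dterm_prod : def.

Lemma pair_sing a b c : pair a b = pair c c -> a = c /\ b = c.
Proof.
move=> ab; have : a ∈ pair c c by rewrite -ab in_pair; left.
have : b ∈ pair c c by rewrite -ab in_pair; right.
by rewrite !in_pair => -[->|->] [->|->].
Qed.

Lemma opair_inj x y x' y' : opair x y = opair x' y' -> x = x' /\ y = y'.
Proof.
move=> H; have E z : (z = pair x x \/ z = pair x y) <-> (z = pair x' x' \/ z = pair x' y').
  by rewrite -!in_pair -/(opair x y) H.
have xx' : x = x'.
  have /E [/pair_sing[]//|/esym/pair_sing[]//] : pair x x = pair x x \/ pair x x = pair x y.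
  by left.
subst x'; split=> //.
have [yx|yx] := classic (y = x).
  have /E [] : pair x y' = pair x x \/ pair x y' = pair x y'; first by right.
    by rewrite yx => /pair_sing[].
  by rewrite yx => /pair_sing[].
have /E [/pair_sing[]//|xy] : pair x y = pair x x \/ pair x y = pair x y; first by right.
have : y ∈ pair x y' by rewrite -xy in_pair; right.
by rewrite in_pair => -[].
Qed.

Lemma in_cup x y z : z ∈ cup x y = (z ∈ x \/ z ∈ y).
Proof.
apply: propositional_extensionality; rewrite in_bigcup; split.
  by move=> [w []]; rewrite in_pair => -[->|->]; [left|right].
by move=> [zx|zy]; [exists x|exists y]; rewrite in_pair; split=> //; [left|right].
Qed.

Lemma in_adj x a z : z ∈ adj x a = (z ∈ x \/ z = a).
Proof.
rewrite in_cup in_pair; apply: propositional_extensionality; tauto.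
Qed.

Lemma in_cap x y z : z ∈ cap x y = (z ∈ x /\ z ∈ y).
Proof. by rewrite in_sep //; solve_def. Qed.

Lemma in_diff x y z : z ∈ diff x y = (z ∈ x /\ z ∉ y).
Proof. by rewrite in_sep //; solve_def. Qed.

Lemma in_del x a z : z ∈ del x a = (z ∈ x /\ z <> a).
Proof. by rewrite in_sep //; solve_def. Qed.

Lemma in_prod x y z : z ∈ prod x y = exists a b, [/\ a ∈ x, b ∈ y & z = opair a b].
Proof.
have dF : dfun1 (fun a => img (opair a) y) by solve_def.
apply: propositional_extensionality; rewrite in_bigcup; split=> [[w []]|[a [b [ax bY ->]]]].
  rewrite in_img // => -[a [ax ->]]; rewrite in_img; last by solve_def.
  by move=> [b [bY ->]]; exists a, b.
exists (img (opair a) y); rewrite in_img //; split; first by exists a.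
by rewrite in_img; [exists b|solve_def].
Qed.

Lemma in_prod_opair x y a b : opair a b ∈ prod x y = (a ∈ x /\ b ∈ y).
Proof.
apply: propositional_extensionality; rewrite in_prod; split; last by move=> []; exists a, b.
by move=> [a' [b' [? ? /opair_inj [-> ->]]]].
Qed.

(** If [x] belonged to itself, the part of [x] consisting of [x] alone would have no minimal
    element. *)
Lemma no_self_mem x : x ∉ x.
Proof.
move=> xx; have dP : drel1 (fun y => y = x) by solve_def.
have ex : exists2 y, y ∈ x & y = x by exists x.
by have [y [_ -> /(_ x xx xx)]] := foundation dP ex.
Qed.

Lemma empty_or x : x = empty \/ exists y, y ∈ x.
Proof.
have [?|nx] := classic (exists y, y ∈ x); first by right.
by left; apply: set_ext => y; rewrite in_empty; split=> // yx; apply: nx; exists y.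
Qed.

Lemma delK x a : a ∈ x -> adj (del x a) a = x.
Proof.
move=> ax; apply: set_ext => y; rewrite in_adj in_del.
split=> [[[]//|->//]|yx]; have [->|] := classic (y = a); first by right.
by left.
Qed.

Lemma adj_id x a : a ∈ x -> adj x a = x.
Proof.
by move=> ax; apply: set_ext => y; rewrite in_adj; split=> [[//|->//]|]; left.
Qed.

End DerivedOperations.

#[local] Hint Resolve dterm_opair dterm_cup dterm_cap dterm_diff dterm_del dterm_adj
  dterm_prod : def.

(** * Meaning of the formulas for sets, functions and natural numbers *)

Section SemanticsSets.
Context {M : zf_model}.
Implicit Types e : nat -> M.

Lemma sem_Empty_eq x : sem (Empty x) (fun e => e x = empty).
Proof.
apply: sem_ext (sem_Empty x) _ => e; split=> [H|-> y]; last by rewrite in_empty.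
by apply: set_ext => y; rewrite in_empty; split=> // /H.
Qed.

Lemma sem_Union_eq x y : sem (Union x y) (fun e => e x = bigcup (e y)).
Proof.
apply: sem_ext (sem_Union x y) _ => e; split=> [H|-> z]; last by rewrite in_bigcup.
by apply: set_ext => z; rewrite in_bigcup.
Qed.

Lemma sem_Upair_eq z x y : sem (Upair z x y) (fun e => e z = pair (e x) (e y)).
Proof.
apply: sem_ext (sem_Upair z x y) _ => e; split=> [H|-> w]; last by rewrite in_pair.
by apply: set_ext => w; rewrite in_pair.
Qed.

Lemma sem_Succ_eq y x : sem (Succ y x) (fun e => e y = adj (e x) (e x)).
Proof.
apply: sem_ext (sem_Succ y x) _ => e; split=> [H|-> w]; last by rewrite in_adj.
by apply: set_ext => w; rewrite in_adj.
Qed.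

Lemma sem_Inter z x y : sem (Inter z x y) (fun e => e z = cap (e x) (e y)).
Proof.
rewrite /Inter; solve_sem => e; split=> [H|-> w]; last by rewrite in_cap.
by apply: set_ext => w; rewrite in_cap.
Qed.

Lemma sem_Diff z x y : sem (Diff z x y) (fun e => e z = diff (e x) (e y)).
Proof.
rewrite /Diff; solve_sem => e; split=> [H|-> w]; last by rewrite in_diff.
by apply: set_ext => w; rewrite in_diff.
Qed.

End SemanticsSets.

#[local] Hint Resolve sem_Sub sem_Empty_eq sem_Disjoint sem_Union_eq sem_Upair_eq sem_Succ_eq
  sem_Inter sem_Diff : sem.

Section SemanticsFunctions.
Context {M : zf_model}.
Implicit Types e : nat -> M.

Lemma sem_Opair z x y : sem (Opair z x y) (fun e => e z = opair (e x) (e y)).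
Proof.
rewrite /Opair; solve_sem => e; split=> [[a [b [-> [-> ->]]]] //|->].
by exists (pair (e x) (e x)), (pair (e x) (e y)).
Qed.

#[local] Hint Resolve sem_Opair : sem.

Lemma sem_App f x y : sem (App f x y) (fun e => opair (e x) (e y) ∈ e f).
Proof.
rewrite /App; solve_sem => e; split=> [[p [pf <-]] //|xyf].
by exists (opair (e x) (e y)).
Qed.

#[local] Hint Resolve sem_App : sem.

Definition func (f x y : M) :=
  (forall p, p ∈ f -> exists a b, [/\ a ∈ x, b ∈ y & p = opair a b]) /\
  (forall a, a ∈ x -> exists b, [/\ b ∈ y, opair a b ∈ f &
     forall b', opair a b' ∈ f -> b' = b]).

Lemma sem_Fun f x y : sem (Fun f x y) (fun e => func (e f) (e x) (e y)).
Proof.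
rewrite /Fun; solve_sem => e; split=> -[fxy ftot]; split.
- by move=> p /fxy[a [ax [b [bY ->]]]]; exists a, b.
- by move=> a /ftot[b [bY [abf fb]]]; exists b.
- by move=> p /fxy[a [b [ax bY ->]]]; exists a; split=> //; exists b.
- by move=> a /ftot[b [bY abf fb]]; exists b.
Qed.

#[local] Hint Resolve sem_Fun : sem.

Definition bij (f x y : M) :=
  func f x y /\ (forall b, b ∈ y -> exists a, [/\ a ∈ x, opair a b ∈ f &
     forall a', opair a' b ∈ f -> a' = a]).

Lemma sem_Bij f x y : sem (Bij f x y) (fun e => bij (e f) (e x) (e y)).
Proof.
rewrite /Bij; solve_sem => e; split=> -[fxy ftot]; split=> // b /ftot[a].
  by move=> [ax [abf fb]]; exists a.
by move=> [ax abf fb]; exists a.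
Qed.

#[local] Hint Resolve sem_Bij : sem.

Definition equip (x y : M) := exists f, bij f x y.

Lemma sem_Equipotent x y : sem (Equipotent x y) (fun e => equip (e x) (e y)).
Proof. by rewrite /Equipotent; solve_sem. Qed.

Definition inductive_set (x : M) := empty ∈ x /\ forall n, n ∈ x -> adj n n ∈ x.

Lemma sem_Inductive_set x :
  sem (Inductive_set x) (fun e => inductive_set (e x)).
Proof.
rewrite /Inductive_set; solve_sem => e; split=> -[x0 xS]; split.
- by have [z [zx <-]] := x0.
- by move=> n /xS[m [mx <-]].
- by exists empty.
- by move=> n /xS; exists (adj n n).
Qed.

#[local] Hint Resolve sem_Inductive_set : sem.

Definition omega : M :=
  the (fun w => inductive_set w /\ forall x, inductive_set x -> w ⊆ x).

Lemma def_inductive_set t : dterm t -> def (fun v => inductive_set (t v)).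
Proof. by apply: def_rel1; rewrite /drel1 /inductive_set; solve_def. Qed.

#[local] Hint Resolve def_inductive_set : def.

(** Infinity provides one inductive set; the elements of it that lie in all inductive sets form the
    least one. *)
Lemma omegaP : inductive_set omega /\ forall x, inductive_set x -> omega ⊆ x.
Proof.
apply: (the_spec (P := fun w => inductive_set w /\
  forall x, inductive_set x -> w ⊆ x)).
zf_ax Infinity => /(_ (fun _ => point M))[I [I0 IS]].
pose w := sep (fun n => forall x, inductive_set x -> n ∈ x) I.
have inw n : n ∈ w = (n ∈ I /\ forall x, inductive_set x -> n ∈ x).
  by rewrite in_sep //; solve_def.
have wind : inductive_set w.
  split; first by rewrite inw; split=> // x [].
  by move=> n; rewrite !inw => -[/IS nI nx]; split=> // x xi; case: (xi) => _; apply; apply: nx.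
have wmin x : inductive_set x -> w ⊆ x by move=> xi z; rewrite inw => -[_]; apply.
exists w; split=> // y [yi ymin].
by apply: set_ext => z; split; [apply: ymin|apply: wmin].
Qed.

Lemma sem_Omega x : sem (Omega x) (fun e => e x = omega).
Proof.
rewrite /Omega; solve_sem => e; have [wi wmin] := omegaP.
split=> [[xi xmin]|-> //]; apply: set_ext => z; split; [exact: xmin|exact: wmin].
Qed.

#[local] Hint Resolve sem_Omega sem_Equipotent : sem.

Definition fin (x : M) := exists n, n ∈ omega /\ equip x n.

Lemma sem_Finite x : sem (Finite x) (fun e => fin (e x)).
Proof. by rewrite /Finite; solve_sem => e; split=> [[w [-> ?]]|]; [|exists omega]. Qed.

Lemma sem_Denumerable x : sem (Denumerable x) (fun e => equip (e x) omega).
Proof. by rewrite /Denumerable; solve_sem => e; split=> [[w [-> ?]]|]; [|exists omega]. Qed.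

Lemma def_fin t : dterm t -> def (fun v => fin (t v)).
Proof. by apply: def_rel1; apply: def_sem (sem_Finite 0). Qed.

Lemma def_equip t u : dterm t -> dterm u -> def (fun v => equip (t v) (u v)).
Proof. by apply: def_rel2; apply: def_sem (sem_Equipotent 0 1). Qed.

End SemanticsFunctions.

#[local] Hint Resolve sem_Opair sem_App sem_Fun sem_Bij sem_Equipotent
  sem_Inductive_set sem_Omega sem_Finite sem_Denumerable : sem.
#[local] Hint Resolve def_inductive_set def_fin def_equip : def.
Arguments omega {M}.
Section NaturalNumbers.
Context {M : zf_model}.
Implicit Types (x y z a b f m n k : M).

Lemma omega0 : empty ∈ (omega : M). Proof. by case: (omegaP (M := M)) => -[]. Qed.

Lemma omegaS n : n ∈ omega -> adj n n ∈ omega.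
Proof. by case: (omegaP (M := M)) => -[_ H _]; apply: H. Qed.

Lemma omega_ind (P : M -> Prop) : drel1 P -> P empty ->
  (forall n, n ∈ omega -> P n -> P (adj n n)) -> forall n, n ∈ omega -> P n.
Proof.
move=> dP P0 PS n nw; have [_ /(_ (sep P omega))] := omegaP (M := M).
suff H : inductive_set (sep P omega) by move=> /(_ H n nw); rewrite in_sep // => -[].
split=> [|m]; rewrite !in_sep //; first by split=> //; apply: omega0.
by move=> [mw Pm]; split; [apply: omegaS|apply: PS].
Qed.

Lemma nat_omega n m : n ∈ omega -> m ∈ n -> m ∈ omega.
Proof.
move=> nw; move: n nw m; apply: omega_ind; first by solve_def.
  by move=> m; rewrite in_empty.
by move=> n nw IH m; rewrite in_adj => -[/IH|->].
Qed.

Lemma nat_trans n m k : n ∈ omega -> m ∈ n -> k ∈ m -> k ∈ n.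
Proof.
move=> nw; move: n nw m k; apply: omega_ind; first by solve_def.
  by move=> m k; rewrite in_empty.
move=> n nw IH m k; rewrite !in_adj => -[mn km|->]; last by left.
by left; apply: IH km.
Qed.

Lemma succ_lt n m : n ∈ omega -> m ∈ n -> adj m m ∈ adj n n.
Proof.
move=> nw; move: n nw m; apply: omega_ind; first by solve_def.
  by move=> m; rewrite in_empty.
move=> n nw IH m; rewrite in_adj => -[/IH mn|->]; rewrite in_adj; first by left.
by right.
Qed.

Lemma zero_le n : n ∈ omega -> n = empty \/ empty ∈ n.
Proof.
move: n; apply: omega_ind; first by solve_def.
  by left.
by move=> n nw [->|n0]; right; rewrite in_adj; [right|left].
Qed.

Lemma nat_total m n : m ∈ omega -> n ∈ omega -> [\/ m ∈ n, m = n | n ∈ m].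
Proof.
move=> mw; move: m mw n; apply: omega_ind.
- by solve_def.
- by move=> n /zero_le[->|]; [constructor 2|constructor 1].
- move=> m mw IH n nw; case: (IH n nw) => [mn|->|nm].
  + have := succ_lt nw mn; rewrite in_adj => -[]; first by constructor 1.
    by constructor 2.
  + by constructor 3; rewrite in_adj; right.
  + by constructor 3; rewrite in_adj; left.
Qed.

Lemma nat_pred n : n ∈ omega -> n = empty \/ exists m, m ∈ omega /\ n = adj m m.
Proof.
move: n; apply: omega_ind; first by solve_def.
  by left.
by move=> n nw _; right; exists n.
Qed.

Lemma succ_neq0 a x : adj x a <> empty.
Proof. by move=> x0; have : a ∈ adj x a by [rewrite in_adj; right]; rewrite x0 in_empty. Qed.

(** Otherwise [m] and [n] would be elements of each other, so that transitivity gives a set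
    belonging to itself. *)
Lemma succ_inj m n : m ∈ omega -> n ∈ omega -> adj m m = adj n n -> m = n.
Proof.
move=> mw nw mn; have : m ∈ adj n n by rewrite -mn in_adj; right.
rewrite in_adj => -[m_n|//]; have : n ∈ adj m m by rewrite mn in_adj; right.
by rewrite in_adj => -[n_m|//]; case: (no_self_mem (nat_trans mw n_m m_n)).
Qed.

Lemma least (P : M -> Prop) n : drel1 P -> n ∈ omega -> P n ->
  exists m, [/\ m ∈ omega, P m & forall k, k ∈ m -> ~ P k].
Proof.
move=> dP nw Pn; have ex : exists2 n, n ∈ omega & P n by exists n.
have [m [mw Pm mP]] := foundation dP ex; exists m; split=> // k km.
by apply: mP => //; apply: nat_omega km.
Qed.

End NaturalNumbers.

(** * Equipotence through definable relations *)

Section Equipotence.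
Context {M : zf_model}.
Implicit Types (x y z a b f m n k : M).

(** A bijection given by a relation of the metatheory instead of a set of pairs. The last clause
    combines single-valuedness and injectivity, and [R] is unconstrained outside [x] and [y]. *)
Definition corr (R : M -> M -> Prop) x y :=
  [/\ forall a, a ∈ x -> exists b, b ∈ y /\ R a b,
      forall b, b ∈ y -> exists a, a ∈ x /\ R a b &
      forall a b a' b', a ∈ x -> b ∈ y -> a' ∈ x -> b' ∈ y -> R a b -> R a' b' ->
        (a = a' <-> b = b')].

(** A definable [R] becomes a set of pairs by separation from the product. *)
Lemma equipI R x y : drel2 R -> corr R x y -> equip x y.
Proof.
move=> dR [Rx Ry Ri].
pose f := sep (fun p => exists a b, p = opair a b /\ R a b) (prod x y).
have inf a b : opair a b ∈ f = (a ∈ x /\ b ∈ y /\ R a b).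
  rewrite in_sep; last by solve_def.
  rewrite in_prod_opair; apply: propositional_extensionality.
  split=> [[[ax bY] [a' [b' [/opair_inj[aa' bb'] ab]]]]|[ax [bY ab]]]; last first.
    by split=> //; exists a, b.
  by subst a' b'.
exists f; split; first split.
- move=> p; rewrite in_sep; last by solve_def.
  by rewrite in_prod => -[[a [b [ax bY ->]]] _]; exists a, b.
- move=> a ax; have [b [bY ab]] := Rx a ax; exists b; rewrite inf; split=> // b'.
  by rewrite inf => -[_ [bY' ab']]; apply/esym/(Ri a b a b').
- move=> b bY; have [a [ax ab]] := Ry b bY; exists a; rewrite inf; split=> // a'.
  by rewrite inf => -[ax' [_ ab']]; apply/esym/(Ri a b a' b).
Qed.

Lemma equipE x y : equip x y -> exists R, [/\ drel2 R, corr R x y &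
  forall a b, R a b -> a ∈ x /\ b ∈ y].
Proof.
move=> [f [[fxy fx] fy]]; exists (fun a b => opair a b ∈ f); split.
- by solve_def.
- split=> [a /fx[b [bY abf _]]|b /fy[a [ax abf _]]|a b a' b' ax bY ax' bY' ab ab'].
  + by exists b.
  + by exists a.
  + have [b1 [_ _ b1P]] := fx a ax; have [a1 [_ _ a1P]] := fy b bY.
    split=> [aa'|bb']; first by rewrite (b1P b) // (b1P b') // aa'.
    by rewrite (a1P a) // (a1P a') // bb'.
- by move=> a b /fxy[a' [b' [? ? /opair_inj[-> ->]]]].
Qed.

Lemma equip_fun (F : M -> M) x y : dfun1 F -> (forall a, a ∈ x -> F a ∈ y) ->
  (forall a a', a ∈ x -> a' ∈ x -> F a = F a' -> a = a') ->
  (forall b, b ∈ y -> exists a, a ∈ x /\ b = F a) -> equip x y.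
Proof.
move=> dF Fy Fi Fs; apply: (@equipI (fun a b => b = F a)); first by solve_def.
split=> // [a ax|a b a' b' ax bY ax' bY' -> ->]; first by exists (F a); split=> //; apply: Fy.
by split=> [->|/Fi]//; apply.
Qed.

Lemma equip_refl x : equip x x.
Proof.
apply: (@equip_fun (fun a => a)) => //; first by solve_def.
by move=> b bx; exists b.
Qed.

Lemma equip_sym x y : equip x y -> equip y x.
Proof.
move=> /equipE[R [dR [Rx Ry Ri] Rxy]]; apply: (@equipI (fun a b => R b a)); first by solve_def.
by split=> // a b a' b' *; symmetry; apply: Ri.
Qed.

Lemma equip_trans x y z : equip x y -> equip y z -> equip x z.
Proof.
move=> /equipE[R [dR [Rx Ry Ri] Rxy]] /equipE[S [dS [Sy Sz Si] Syz]].
apply: (@equipI (fun a c => exists b, R a b /\ S b c)); first by solve_def.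
split=> [a /Rx[b [/Sy[c [cz bc]] ab]]|c /Sz[b [/Ry[a [ax ab]] bc]]|].
- by exists c; split=> //; exists b.
- by exists a; split=> //; exists b.
- move=> a c a' c' ax cz ax' cz' [b [ab bc]] [b' [ab' bc']].
  have [_ bY] := Rxy _ _ ab; have [_ bY'] := Rxy _ _ ab'.
  by rewrite (Ri a b a' b') // (Si b c b' c').
Qed.

End Equipotence.

(** * Finite sets *)

Section Finiteness.
Context {M : zf_model}.
Implicit Types (x y z a b f m n k : M).

Definition card a n := n ∈ omega /\ equip a n.

Lemma def_card t u : dterm t -> dterm u -> def (fun v => card (t v) (u v)).
Proof. by apply: def_rel2; rewrite /drel2 /card; solve_def. Qed.

#[local] Hint Resolve def_card : def.

Lemma card0 : card empty empty.
Proof. by split; [apply: omega0|apply: equip_refl]. Qed.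

Lemma card_eq0 a : card a empty -> a = empty.
Proof.
move=> [_ /equipE[R [_ [Ra _ _] _]]]; case: (empty_or a) => // -[x /Ra[b []]].
by rewrite in_empty.
Qed.

Lemma card_adj a n x : card a n -> x ∉ a -> card (adj a x) (adj n n).
Proof.
move=> [nw /equipE[R [dR [Ra Rn Ri] Ran]]] xa; split; first exact: omegaS.
apply: (@equipI _ (fun y k => R y k \/ y = x /\ k = n)); first by solve_def.
split=> [y|k|y k y' k' _ _ _ _].
- rewrite in_adj => -[/Ra[k [kn yk]]|->]; last first.
    by exists n; rewrite in_adj; split; right.
  by exists k; rewrite in_adj; split; left.
- rewrite in_adj => -[/Rn[y [ya yk]]|->]; last first.
    by exists x; rewrite in_adj; split; right.
  by exists y; rewrite in_adj; split; left.
- have nn := @no_self_mem _ n.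
  move=> [yk|[-> ->]] [yk'|[-> ->]] //; first exact: Ri (proj1 (Ran _ _ yk))
    (proj2 (Ran _ _ yk)) (proj1 (Ran _ _ yk')) (proj2 (Ran _ _ yk')) yk yk'.
  + by have [ya kn] := Ran _ _ yk; split=> E; subst.
  + by have [ya kn] := Ran _ _ yk'; split=> E; subst.
Qed.

Lemma card_del_ex a n : n ∈ omega -> card a (adj n n) ->
  exists x, x ∈ a /\ card (del a x) n.
Proof.
move=> nw [_ /equipE[R [dR [Ra Rn Ri] Ran]]].
have nn : n ∈ adj n n by rewrite in_adj; right.
have [x [xa xn]] := Rn n nn; exists x; split=> //; split=> //.
apply: (equipI dR); split=> [y|k kn|y k y' k'].
- rewrite in_del => -[ya yx]; have [k [kn yk]] := Ra y ya; exists k; split=> //.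
  move: kn; rewrite in_adj => -[//|kn]; case: yx.
  by apply/(Ri y k x n) => //; rewrite kn.
- have kn' : k ∈ adj n n by rewrite in_adj; left.
  have [y [ya yk]] := Rn k kn'; exists y; rewrite in_del; split=> //; split=> // yx.
  apply: (@no_self_mem _ n); suff {1}<- : k = n by [].
  by apply/(Ri y k x n).
- rewrite !in_del => -[ya _] kn [ya' _] kn'; apply: Ri => //; rewrite in_adj; by left.
Qed.

(** [card_del_ex] removes the particular element matched with the top of the successor. For another
    element [x], remove that one, call it [y], then [x] by induction, and put [y] back. *)
Lemma card_del n : n ∈ omega -> forall a x, card a (adj n n) -> x ∈ a ->
  card (del a x) n.
Proof.
move: n; apply: omega_ind; first by solve_def.
  move=> a x a1 xa; have [y [ya ay]] := card_del_ex omega0 a1.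
  have [<- //|xy] := classic (y = x).
  have : x ∈ del a y by rewrite in_del; split=> // yx; apply: xy.
  by rewrite (card_eq0 ay) in_empty.
move=> n nw IH a x a2 xa; have [y [ya ay]] := card_del_ex (omegaS nw) a2.
have [<- //|xy] := classic (y = x).
have xay : x ∈ del a y by rewrite in_del; split=> // yx; apply: xy.
have := IH _ _ ay xay; move/card_adj => /(_ y).
have -> : adj (del (del a y) x) y = del a x.
  apply: set_ext => z; rewrite in_adj !in_del.
  split=> [[[[za _] zx]|->]//|[za zx]].
  by have [->|] := classic (z = y); [right|left].
by apply; rewrite !in_del => -[[]].
Qed.

Lemma fin_ind (P : M -> Prop) : drel1 P -> P empty ->
  (forall a x, fin a -> x ∉ a -> P a -> P (adj a x)) -> forall a, fin a -> P a.
Proof.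
move=> dP P0 PS a [n [nw an]]; have : card a n by [].
move: nw a {an}; move: n; apply: omega_ind; first by solve_def.
  by move=> a /card_eq0 ->.
move=> n nw IH a a1; have [x [xa ax]] := card_del_ex nw a1.
rewrite -(delK xa); apply: PS; last exact: IH.
  by exists n.
by rewrite in_del => -[].
Qed.

Lemma fin_empty : fin (empty : M). Proof. by exists empty; apply: card0. Qed.

Lemma fin_adj a x : fin a -> fin (adj a x).
Proof.
move=> fa; have [xa|xa] := classic (x ∈ a); first by rewrite adj_id.
by case: fa => n an; exists (adj n n); apply: card_adj.
Qed.

(** The relation may be partial on [a] and has to be single-valued only within [b]. By induction on
    [a]: a new element reaches at most one point of [b], and the points reached from the rest form a
    finite set. *)
Lemma fin_image (R : M -> M -> Prop) a b : drel2 R -> fin a ->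
  (forall x y y', x ∈ a -> y ∈ b -> y' ∈ b -> R x y -> R x y' -> y = y') ->
  (forall y, y ∈ b -> exists x, x ∈ a /\ R x y) -> fin b.
Proof.
move=> dR fa; move: a fa b; apply: fin_ind; first by solve_def.
  move=> b _ bP; case: (empty_or b) => [->|[y /bP[x []]]]; first exact: fin_empty.
  by rewrite in_empty.
move=> a x fa xa IH b Rf Rs.
pose b' := sep (fun y => exists x, x ∈ a /\ R x y) b.
have inb' y : y ∈ b' = (y ∈ b /\ exists x, x ∈ a /\ R x y) by rewrite in_sep //; solve_def.
have fb' : fin b'.
  apply: IH => [x' y y' x'a|y]; rewrite !inb'; last by case.
  by move=> [yb _] [yb' _]; apply: Rf => //; rewrite in_adj; left.
have xx : x ∈ adj a x by rewrite in_adj; right.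
have [[y0 [y0b xy0]]|ny] := classic (exists y, y ∈ b /\ R x y).
  have [y0b'|y0b'] := classic (y0 ∈ b').
    suff <- : b' = b by [].
    apply: set_ext => y; rewrite inb'; split=> [[]//|yb]; split=> //.
    have [x' []] := Rs y yb; rewrite in_adj => -[x'a x'y|-> xy]; first by exists x'.
    by rewrite (Rf x y y0) //; move: y0b'; rewrite inb' => -[].
  suff <- : adj b' y0 = b by apply: fin_adj.
  apply: set_ext => y; rewrite in_adj inb'; split=> [[[]//|->//]|yb].
  have [x' []] := Rs y yb; rewrite in_adj => -[x'a x'y|-> xy]; last first.
    by right; apply: Rf xy xy0.
  by left; split=> //; exists x'.
suff <- : b' = b by [].
apply: set_ext => y; rewrite inb'; split=> [[]//|yb]; split=> //.
have [x' []] := Rs y yb; rewrite in_adj => -[x'a x'y|-> xy]; first by exists x'.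
by case: ny; exists y.
Qed.

Lemma fin_sub a b : fin a -> b ⊆ a -> fin b.
Proof.
move=> fa ba; apply: (@fin_image (fun x y => x = y)) fa _ _; first by solve_def.
  by move=> x y y' _ _ _ <- <-.
by move=> y /ba; exists y.
Qed.

Lemma fin_img (F : M -> M) a : dfun1 F -> fin a -> fin (img F a).
Proof.
move=> dF fa; apply: (@fin_image (fun x y => y = F x)) fa _ _; first by solve_def.
  by move=> x y y' _ _ _ -> ->.
by move=> y; rewrite in_img.
Qed.

Lemma fin_inj (F : M -> M) a b : dfun1 F -> fin b -> (forall x, x ∈ a -> F x ∈ b) ->
  (forall x y, x ∈ a -> y ∈ a -> F x = F y -> x = y) -> fin a.
Proof.
move=> dF fb Fb Fi; apply: (@fin_image (fun x y => x = F y)) fb _ _; first by solve_def.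
  by move=> x y y' _ ya ya' -> /Fi; apply.
by move=> y ya; exists (F y); split=> //; apply: Fb.
Qed.

Lemma fin_equip a b : equip a b -> fin a -> fin b.
Proof.
move=> /equip_sym ba [n [nw an]]; exists n; split=> //.
exact: equip_trans ba an.
Qed.

Lemma fin_cup a b : fin a -> fin b -> fin (cup a b).
Proof.
move=> fa fb; move: a fa; apply: fin_ind; first by solve_def.
  suff -> : cup empty b = b by [].
  by apply: set_ext => z; rewrite in_cup in_empty; split=> [[]//|]; right.
move=> a x _ _ fab; suff -> : cup (adj a x) b = adj (cup a b) x by apply: fin_adj.
by apply: set_ext => z; rewrite !(in_cup, in_adj); tauto.
Qed.

Lemma fin_bigcup a : fin a -> (forall x, x ∈ a -> fin x) -> fin (bigcup a).
Proof.
move: a; apply: fin_ind; first by solve_def.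
  move=> _; suff -> : bigcup empty = empty by apply: fin_empty.
  by move=> ?; apply: set_ext => z; rewrite in_bigcup in_empty; split=> // -[w []]; rewrite in_empty.
move=> a x _ _ IH fax.
have -> : bigcup (adj a x) = cup (bigcup a) x.
  apply: set_ext => z; rewrite in_cup !in_bigcup; split.
    by move=> [w []]; rewrite in_adj => -[wa|->] zw; [left; exists w|right].
  move=> [[w [wa zw]]|zx]; first by exists w; rewrite in_adj; split=> //; left.
  by exists x; rewrite in_adj; split=> //; right.
apply: fin_cup; last by apply: fax; rewrite in_adj; right.
by apply: IH => y ya; apply: fax; rewrite in_adj; left.
Qed.

(** A subset of [adj a x] is a subset of [a], or arises from one by adding [x]. *)
Lemma fin_pow a : fin a -> fin (pow a).
Proof.
move: a; apply: fin_ind; first by solve_def.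
  apply: (fin_sub (fin_adj empty fin_empty)) => z; rewrite in_pow in_adj => z0.
  right; apply: set_ext => y; rewrite in_empty; split=> // /z0.
  by rewrite in_empty.
move=> a x fa xa fpa.
have dF : dfun1 (fun b => adj b x) by solve_def.
apply: (fin_sub (fin_cup fpa (fin_img dF fpa))) => b; rewrite in_cup in_img // !in_pow => bax.
have [xb|xb] := classic (x ∈ b); [right|left].
  exists (del b x); rewrite delK // in_pow; split=> // z; rewrite in_del => -[/bax].
  by rewrite in_adj => -[].
by move=> z zb; move: (bax z zb); rewrite in_adj => -[//|zx]; rewrite zx in zb.
Qed.

Lemma fin_bounded a : fin a -> a ⊆ omega ->
  exists n, n ∈ omega /\ forall k, k ∈ a -> k ∈ n.
Proof.
move: a; apply: fin_ind; first by solve_def.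
  by move=> _; exists empty; split=> [|k]; [exact: omega0|rewrite in_empty].
move=> a x fa xa IH aw.
have [z za|n [nw nP]] := IH; first by apply: aw; rewrite in_adj; left.
have xw : x ∈ omega by apply: aw; rewrite in_adj; right.
case: (nat_total nw (omegaS xw)) => [nx|nx|xn].
- exists (adj x x); split=> [|k]; first exact: omegaS.
  by rewrite in_adj => -[/nP kn|->]; [apply: nat_trans nx kn; exact: omegaS|rewrite in_adj; right].
- exists n; split=> // k; rewrite in_adj => -[/nP//|->].
  by rewrite nx in_adj; right.
- exists n; split=> // k; rewrite in_adj => -[/nP//|->].
  by apply: nat_trans xn _; rewrite // in_adj; right.
Qed.

Lemma omega_infinite : ~ fin (omega : M).
Proof.
by move=> /fin_bounded [//|n [nw /(_ n nw)/no_self_mem]].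
Qed.

Lemma denumerable_infinite d a : equip d omega -> d ⊆ a -> ~ fin a.
Proof.
by move=> dw da fa; apply: omega_infinite; apply: fin_equip dw (fin_sub fa da).
Qed.

Lemma fin_nat n : n ∈ omega -> fin n.
Proof. by exists n; split=> //; apply: equip_refl. Qed.

End Finiteness.

#[local] Hint Resolve def_card : def.

(** * Iteration and hitting sets *)

Section Iteration.
Context {M : zf_model}.
Implicit Types (x y z a b f m n k : M).

(** Recursion along [omega]. The graph [r] is the least relation that starts at [a0] and is closed
    under [G]; the strict order [lt] makes its values pairwise distinct, so their set is denumerable
    without any choice. *)
Lemma iterate (A a0 : M) (G : M -> M) (lt : M -> M -> Prop) :
  dfun1 G -> drel2 lt -> a0 ∈ A -> (forall x, x ∈ A -> G x ∈ A /\ lt x (G x)) ->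
  (forall x y z, lt x y -> lt y z -> lt x z) -> (forall x, ~ lt x x) ->
  exists d, d ⊆ A /\ equip d omega.
Proof.
move=> dG dlt a0A GA ltT ltI.
pose closed r := opair empty a0 ∈ r /\
  forall n x, n ∈ omega -> x ∈ A -> opair n x ∈ r -> opair (adj n n) (G x) ∈ r.
have dcl : drel1 closed by rewrite /closed; solve_def.
pose r := sep (fun p => forall s, closed s -> p ∈ s) (prod omega A).
have inr n x : opair n x ∈ r <-> [/\ n ∈ omega, x ∈ A & forall s, closed s -> opair n x ∈ s].
  rewrite in_sep; last by solve_def.
  by rewrite in_prod_opair; split=> [[[]]|[]].
have rcl : closed r.
  split=> [|n x nw xA]; rewrite !inr; first by split=> // [|s []//]; exact: omega0.
  move=> [_ _ H]; split; [exact: omegaS | by case: (GA x xA)|].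
  by move=> s cs; case: (cs) => _; apply=> //; apply: H.
(* Inversion for the least relation: the pairs of [r] having one of the two forms are themselves
   closed. *)
have rinv n x : opair n x ∈ r -> (n = empty /\ x = a0) \/
    exists m y, [/\ opair m y ∈ r, n = adj m m & x = G y].
  move=> nx; have [nw xA nxP] := (inr n x).1 nx.
  pose Q n x := (n = empty /\ x = a0) \/ 
    exists m y, [/\ opair m y ∈ r, n = adj m m & x = G y].
  pose s := sep (fun p => exists n x, p = opair n x /\ Q n x) r.
  have ins n' x' : opair n' x' ∈ s <-> opair n' x' ∈ r /\ Q n' x'.
    rewrite in_sep; last by rewrite /Q; solve_def.
    split=> [[nr [n1 [x1 [/opair_inj[E1 E2] H]]]]|[? ?]]; first by subst.
    by split=> //; exists n', x'.
  have : closed s.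
    split; first by apply/ins; split; [case: rcl|left].
    move=> n' x' n'w x'A /ins[rn' _]; apply/ins; split; last by right; exists n', x'.
    by case: rcl => _; apply.
  by move/nxP => /ins[].
have rfun n : n ∈ omega -> forall x y, opair n x ∈ r -> opair n y ∈ r -> x = y.
  move: n; apply: omega_ind; first by solve_def.
    move=> x y /rinv[[_ ->]|[m [z [_ /esym/succ_neq0//]]]].
    by move=> /rinv[[_ ->]//|[m [z [_ /esym/succ_neq0//]]]].
  move=> n nw IH x y /rinv[[/succ_neq0//]|[m [z [mz nm ->]]]].
  move=> /rinv[[/succ_neq0//]|[m' [z' [mz' nm' ->]]]].
  have [mw _ _] := (inr _ _).1 mz; have [mw' _ _] := (inr _ _).1 mz'.
  move/(succ_inj nw mw): nm => nm; move/(succ_inj nw mw'): nm' => nm'.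
  by congr G; subst; apply: IH.
have rtot n : n ∈ omega -> exists x, opair n x ∈ r.
  move: n; apply: omega_ind; first by solve_def.
    by exists a0; case: rcl.
  move=> n nw [x nx]; exists (G x); have [_ xA _] := (inr _ _).1 nx.
  by case: rcl => _; apply.
have rlt n : n ∈ omega -> forall m x y, m ∈ n -> opair m x ∈ r -> opair n y ∈ r -> lt x y.
  move: n; apply: omega_ind; first by solve_def.
    by move=> m x y; rewrite in_empty.
  move=> n nw IH m x y mn mx /rinv[[/succ_neq0//]|[m' [z [mz nm ->]]]].
  have [mw zA _] := (inr _ _).1 mz.
  move/(succ_inj nw mw): nm => nm; subst m'.
  have [_ zG] := GA z zA; move: mn; rewrite in_adj => -[mn|mn]; last first.
    by subst m; rewrite (rfun n nw x z).
  by apply: ltT zG; apply: IH mn mx mz.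
pose d := sep (fun x => exists n, opair n x ∈ r) A.
have ind x : x ∈ d = (x ∈ A /\ exists n, opair n x ∈ r) by rewrite in_sep //; solve_def.
exists d; split=> [x|]; first by rewrite ind => -[].
apply: (@equipI _ (fun x n => opair n x ∈ r)); first by solve_def.
split=> [x|n /rtot[x nx]|x n y m _ nw _ mw nx my].
- by rewrite ind => -[_ [n nx]]; exists n; split=> //; case/inr: nx.
- by exists x; rewrite ind; have [_ xA _] := (inr _ _).1 nx; split=> //; split=> //; exists n.
- split=> [xy|nm]; last by subst m; apply: rfun nx my.
  subst y; case: (nat_total nw mw) => // [nm|mn].
    by case: (ltI x); apply: rlt nm nx my.
  by case: (ltI x); apply: rlt mn my nx.
Qed.

Definition cellular (c t : M) :=
  [/\ c ⊆ t, forall u, u ∈ c -> u <> empty &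
      forall u v, u ∈ c -> v ∈ c -> u <> v -> forall z, ~ (z ∈ u /\ z ∈ v)].

(** Some [V n] may be empty. The indices of nonempty members are unbounded, so iterating the step to
    the next such index gives a denumerable set of them; disjointness makes [V] injective there. *)
Lemma cellularI t (V : M -> M) : dfun1 V -> (forall n, n ∈ omega -> V n ∈ t) ->
  (forall m n y, m ∈ omega -> n ∈ omega -> y ∈ V m -> y ∈ V n -> m = n) ->
  (forall N, N ∈ omega -> exists n, [/\ n ∈ omega, N ∈ n & exists y, y ∈ V n]) ->
  exists c, equip c omega /\ cellular c t.
Proof.
move=> dV Vt Vdisj Vunb.
pose I := sep (fun n => exists y, y ∈ V n) omega.
have inI n : n ∈ I = (n ∈ omega /\ exists y, y ∈ V n) by rewrite in_sep //; solve_def.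
pose next n m := (m ∈ I /\ n ∈ m) /\ forall k, k ∈ m -> ~ (k ∈ I /\ n ∈ k).
have dnext : drel2 next by rewrite /next; solve_def.
pose G n := the (next n).
have dG : dfun1 G by rewrite /G /dfun1; solve_def.
have GP n : n ∈ omega -> next n (G n).
  move=> nw; apply: the_spec; have [m [mw nm ym]] := Vunb n nw.
  have dP : drel1 (fun m => m ∈ I /\ n ∈ m) by solve_def.
  have [|k [kw kP kmin]] := least dP mw; first by rewrite inI.
  exists k; split=> // j [[jI nj] jmin].
  have jw : j ∈ omega by move: jI; rewrite inI => -[].
  by case: (nat_total kw jw) => // [/jmin|/kmin] [].
have [n0 [n0w _ y0]] := Vunb _ omega0.
have n0I : n0 ∈ I by rewrite inI.
have [d [dI dw]] : exists d, d ⊆ I /\ equip d omega.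
  apply: (@iterate I n0 G (fun m n => n ∈ omega /\ m ∈ n)) => // [|n|m n k|n].
  - by solve_def.
  - rewrite inI => -[nw _]; have [[GI nG] _] := GP n nw; split=> //; split=> //.
    by move: GI; rewrite inI => -[].
  - by move=> [nw mn] [kw nk]; split=> //; apply: nat_trans kw nk mn.
  - by move=> [_ /no_self_mem].
have dP n : n ∈ d -> n ∈ omega /\ exists y, y ∈ V n by move=> /dI; rewrite inI.
exists (img V d); split.
  apply: equip_trans dw; apply: equip_sym; apply: (@equip_fun _ V) => //.
  - by move=> n nd; rewrite in_img //; exists n.
  - move=> m n /dP[mw [y ym]] /dP[nw _] mn; apply: (Vdisj m n y) => //.
    by rewrite -mn.
  - by move=> u; rewrite in_img.
split=> [u|u|u v]; rewrite !in_img //.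
- by move=> [n [/dP[nw _] ->]]; apply: Vt.
- by move=> [n [/dP[_ [y yn]] ->]] V0; move: yn; rewrite V0 in_empty.
- move=> [m [/dP[mw _] ->]] [n [/dP[nw _] ->]] mn z [zm zn].
  by apply: mn; rewrite (Vdisj m n z).
Qed.

End Iteration.

Section HittingSets.
Context {M : zf_model}.
Implicit Types (x y z a b f m n k S T X : M).

Definition hits T S := forall s, s ∈ S -> exists x, x ∈ s /\ x ∈ T.

Lemma def_hits t u : dterm t -> dterm u -> def (fun v => hits (t v) (u v)).
Proof. by apply: def_rel2; rewrite /drel2 /hits; solve_def. Qed.

#[local] Hint Resolve def_hits : def.

(* If no set with fewer than [n] elements hits [S], a hitting set with [n]
   elements consists of an element [x] of a fixed [s ∈ S] and a hitting set with
   [n - 1] elements of the members of [S] not containing [x]. *)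
Lemma fin_hitting X n : n ∈ omega -> forall S,
  (forall s, s ∈ S -> fin s /\ s ⊆ X) ->
  (forall T k, T ⊆ X -> hits T S -> card T k -> k ∉ n) ->
  fin (sep (fun T => hits T S /\ card T n) (pow X)).
Proof.
have inH S m T : T ∈ sep (fun T => hits T S /\ card T m) (pow X) =
    (T ⊆ X /\ hits T S /\ card T m).
  by rewrite in_sep ?in_pow //; solve_def.
move: n; apply: omega_ind.
- by solve_def.
- move=> S _ _; apply: (fin_sub (fin_adj empty fin_empty)) => T.
  by rewrite inH in_adj => -[_ [_ /card_eq0]]; right.
move=> n nw IH S SP Smin.
have [s sS] : exists s, s ∈ S.
  case: (empty_or S) => // S0; case: (Smin empty empty).
  - by move=> z; rewrite in_empty.
  - by move=> s; rewrite S0 in_empty.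
  - exact: card0.
  - by case: (zero_le (omegaS nw)) => // /succ_neq0.
have [fs sX] := SP s sS.
pose S' x := sep (fun s => x ∉ s) S.
have inS' x s' : s' ∈ S' x = (s' ∈ S /\ x ∉ s') by rewrite in_sep //; solve_def.
pose H x := sep (fun T => hits T (S' x) /\ card T n) (pow X).
have dadj x : dfun1 (fun T => adj T x) by solve_def.
have dH : dfun1 (fun x => img (fun T => adj T x) (H x)).
  by rewrite /H /S' /dfun1; solve_def.
apply: (@fin_sub _ (bigcup (img (fun x => img (fun T => adj T x) (H x)) s))).
  apply: fin_bigcup; first exact: fin_img.
  move=> y; rewrite in_img // => -[x [xs ->]]; apply: fin_img => //.
  (* A set hitting [S' x] with fewer than [n] elements would, after adding [x], hit [S] with at most
     [n] elements, against the minimality for [adj n n]. *)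
  apply: IH => [s'|T k TX ThS Tk kn]; first by rewrite inS' => -[/SP].
  have ThS' : hits (adj T x) S.
    move=> s' s'S; have [xs'|xs'] := classic (x ∈ s').
      by exists x; rewrite in_adj; split=> //; right.
    have [|z [zs' zT]] := ThS s'; first by rewrite inS'.
    by exists z; rewrite in_adj; split=> //; left.
  have TxX : adj T x ⊆ X by move=> z; rewrite in_adj => -[/TX|->]; last apply: sX.
  have [xT|xT] := classic (x ∈ T).
    by rewrite adj_id // in ThS'; apply: (Smin T k) => //; rewrite in_adj; left.
  by apply: (Smin (adj T x) (adj k k)) => //; [apply: card_adj|apply: succ_lt].
move=> T; rewrite inH => -[TX [Thit Tn]]; have [x [xs xT]] := Thit s sS.
rewrite in_bigcup; exists (img (fun T => adj T x) (H x)); split.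
  by rewrite in_img //; exists x.
rewrite in_img //; exists (del T x); rewrite delK //; split=> //.
rewrite inH; split; first by move=> z; rewrite in_del => -[/TX].
split; last exact: card_del.
move=> s'; rewrite inS' => -[/Thit[y [ys' yT]] xs']; exists y; split=> //.
by rewrite in_del; split=> // yx; rewrite yx in ys'.
Qed.

(* [empty] if no finite subset of [X] hits [S]. *)
Definition least_hitting X S : M := sep (fun T => hits T S /\
  exists n, card T n /\ forall T' k, T' ⊆ X -> hits T' S -> card T' k -> k ∉ n) (pow X).

Lemma dterm_least_hitting t u :
  dterm t -> dterm u -> dterm (fun v => least_hitting (t v) (u v)).
Proof. by apply: dterm_fun2; rewrite /dfun2 /least_hitting; solve_def. Qed.

Lemma in_least_hitting X S T : T ∈ least_hitting X S =
  (T ⊆ X /\ hits T S /\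
   exists n, card T n /\ forall T' k, T' ⊆ X -> hits T' S -> card T' k -> k ∉ n).
Proof. by rewrite in_sep ?in_pow //; solve_def. Qed.

(** All least hitting sets have the same size, so [fin_hitting] bounds their number. *)
Lemma fin_least_hitting X S : (forall s, s ∈ S -> fin s /\ s ⊆ X) ->
  fin (bigcup (least_hitting X S)).
Proof.
move=> SP; apply: fin_bigcup; last first.
  by move=> T; rewrite in_least_hitting => -[_ [_ [n [? _]]]]; exists n.
case: (empty_or (least_hitting X S)) => [->|[T]]; first exact: fin_empty.
rewrite in_least_hitting => -[TX [Thit [n [[nw Tn] Tmin]]]].
apply: fin_sub (fin_hitting nw SP Tmin) _ => T'; rewrite in_least_hitting.
move=> [T'X [T'hit [m [T'm T'min]]]]; rewrite in_sep; last by solve_def.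
rewrite in_pow; split=> //; split=> //; suff -> : n = m by [].
have [mw _] := T'm; case: (nat_total nw mw) => // [nm|mn].
  by case: (T'min T n TX Thit).
by case: (Tmin T' m T'X T'hit).
Qed.

Lemma least_hitting_ex X S T : T ⊆ X -> fin T -> hits T S ->
  exists T', T' ∈ least_hitting X S.
Proof.
move=> TX [n [nw Tn]] Thit.
have dP : drel1 (fun n => exists T, [/\ T ⊆ X, hits T S & card T n]) by solve_def.
have [|m [mw [T' [T'X T'hit T'm]] mmin]] := least dP nw; first by exists T.
exists T'; rewrite in_least_hitting; split=> //; split=> //; exists m; split=> //.
by move=> T1 k T1X T1hit T1k km; case: (mmin k km); exists T1.
Qed.

End HittingSets.

#[local] Hint Resolve def_hits dterm_least_hitting : def.

(** * Topological spaces and Cantor cubes *)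

Section Topologies.
Context {M : zf_model}.

Definition topology (t x : M) :=
  [/\ forall u, u ∈ t -> u ⊆ x, empty ∈ t, x ∈ t, forall F, F ⊆ t -> bigcup F ∈ t &
      forall u v, u ∈ t -> v ∈ t -> cap u v ∈ t].

Lemma sem_Topology t x : sem (Topology t x) (fun e : nat -> M => topology (e t) (e x)).
Proof.
rewrite /Topology; solve_sem => e; split=> [[tx [[z [zt zE]] [xt [tU tI]]]]|[tx t0 xt tU tI]].
  subst z; split=> // [F /tU[u [ut <-]]|u v ut vt] //.
  by have [w [wt <-]] := tI u ut v vt.
do 2 (split=> //); first by exists empty.
split=> //; split=> [F /tU|u ut v vt]; first by exists (bigcup F).
by exists (cap u v); split=> //; apply: tI.
Qed.

#[local] Hint Resolve sem_Topology : sem.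

Definition hausdorff (t x : M) := forall a b, a ∈ x -> b ∈ x -> a <> b ->
  exists u v, [/\ u ∈ t, v ∈ t, a ∈ u, b ∈ v & forall z, ~ (z ∈ u /\ z ∈ v)].

Lemma sem_Hausdorff t x : sem (Hausdorff t x) (fun e : nat -> M => hausdorff (e t) (e x)).
Proof.
rewrite /Hausdorff; solve_sem => e; split=> H.
  move=> a b ax bx ab; have [u [ut [v [vt [au [bv uv]]]]]] := H a ax b bx ab.
  by exists u, v.
move=> a ax b bx ab; have [u [v [ut vt au bv uv]]] := H a b ax bx ab.
by exists u; split=> //; exists v.
Qed.

Definition clopen (u t x : M) := u ∈ t /\ diff x u ∈ t.

Lemma sem_Clopen u t x :
  sem (Clopen u t x) (fun e : nat -> M => clopen (e u) (e t) (e x)).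
Proof.
rewrite /Clopen; solve_sem => e; split=> -[ut dt]; split=> //.
  by have [w [wt <-]] := dt.
by exists (diff (e x) (e u)).
Qed.

#[local] Hint Resolve sem_Clopen : sem.

Definition zero_dimensional (t x : M) :=
  forall u a, u ∈ t -> a ∈ u -> exists w, [/\ clopen w t x, a ∈ w & w ⊆ u].

(** If any clopen base exists, the set of all clopen sets is one; this removes the quantifier over
    bases. *)
Lemma sem_ZeroDimensional t x :
  sem (ZeroDimensional t x) (fun e : nat -> M => zero_dimensional (e t) (e x)).
Proof.
rewrite /ZeroDimensional /Base; solve_sem => e; split=> [[b [[bt tb] bclopen]] u a ut au|zd].
  have [b' [b'b uE]] := tb u ut; move: au; rewrite uE in_bigcup => -[w [wb' aw]].
  exists w; split=> //; first by apply/bclopen/b'b.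
  by move=> z zw; rewrite in_bigcup; exists w.
pose b := sep (fun w => clopen w (e t) (e x)) (e t).
have inb w : w ∈ b = (w ∈ e t /\ clopen w (e t) (e x)).
  by rewrite in_sep // /clopen; solve_def.
exists b; split; last by move=> w; rewrite inb => -[].
split=> [w|u ut]; first by rewrite inb => -[].
exists (sep (fun w => w ⊆ u) b); have dP : drel1 (fun w => w ⊆ u) by solve_def.
split=> [w|]; first by rewrite in_sep // => -[].
apply: set_ext => a; rewrite in_bigcup; split=> [/(zd u a ut)[w [wc aw wu]]|[w []]].
  by exists w; rewrite in_sep // inb; split=> //; split=> //; split=> //; case: wc.
by rewrite in_sep // => -[_ wu] /wu.
Qed.

Lemma sem_Subspace s y t : sem (Subspace s y t)
  (fun e : nat -> M => forall v, v ∈ e s <-> exists u, u ∈ e t /\ v = cap u (e y)).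
Proof. by rewrite /Subspace; solve_sem. Qed.

Lemma sem_Cellular c t : sem (Cellular c t) (fun e : nat -> M => cellular (e c) (e t)).
Proof.
rewrite /Cellular; solve_sem => e; split=> [[ct [c0 cd]]|[ct c0 cd]]; split=> //.
  by move=> u v uc vc uv; apply: cd.
by split=> // u uc v vc uv; apply: cd.
Qed.

Lemma clopen_cap t x u v : topology t x -> clopen u t x -> clopen v t x ->
  clopen (cap u v) t x.
Proof.
move=> [_ _ _ tU tI] [ut ut'] [vt vt']; split; first exact: tI.
suff -> : diff x (cap u v) = bigcup (pair (diff x u) (diff x v)).
  by apply: tU => w; rewrite in_pair => -[->|->].
apply: set_ext => z; rewrite in_diff in_cap -/(cup _ _) in_cup !in_diff.
by have [] := classic (z ∈ u); have [] := classic (z ∈ v); tauto.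
Qed.

Lemma clopen_diff t x u : topology t x -> clopen u t x -> clopen (diff x u) t x.
Proof.
move=> [tx _ _ _ _] [ut ut']; split=> //; suff -> : diff x (diff x u) = u by [].
apply: set_ext => z; rewrite !in_diff; split=> [[zx]|zu].
  by have [] := classic (z ∈ u); tauto.
by split; [apply: tx zu|tauto].
Qed.

Lemma clopen_self t x : topology t x -> clopen x t x.
Proof.
move=> [_ t0 xt _ _]; split=> //; suff -> : diff x x = empty by [].
by apply: set_ext => z; rewrite in_diff in_empty; tauto.
Qed.

(** The set is the union of all its open subsets, so no neighbourhood has to be chosen at each
    point. *)
Lemma open_local t x u : topology t x ->
  (forall a, a ∈ u -> exists w, [/\ w ∈ t, a ∈ w & w ⊆ u]) -> u ∈ t.
Proof.
move=> [_ _ _ tU _] uP; have dP : drel1 (fun w => w ⊆ u) by solve_def.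
suff -> : u = bigcup (sep (fun w => w ⊆ u) t) by apply: tU => w; rewrite in_sep // => -[].
apply: set_ext => a; rewrite in_bigcup; split=> [/uP[w [wt aw wu]]|[w []]].
  by exists w; rewrite in_sep.
by rewrite in_sep // => -[_ wu] /wu.
Qed.

End Topologies.

#[local] Hint Resolve sem_Topology sem_Hausdorff sem_Clopen sem_ZeroDimensional
  sem_Subspace sem_Cellular : sem.

Section CantorCubes.
Context {M : zf_model}.

Definition one : M := pair empty empty.
Definition two : M := pair empty one.

Lemma sem_Two z : sem (Two z) (fun e : nat -> M => e z = two).
Proof.
rewrite /Two; solve_sem => e; split=> [[a [b [-> [-> ->]]]] //|->].
by exists empty, one.
Qed.

Definition preimage (s c a u : M) :=
  forall f, f ∈ s <-> f ∈ c /\ exists y, y ∈ u /\ opair a y ∈ f.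

Lemma sem_Preimage s c a u :
  sem (Preimage s c a u) (fun e : nat -> M => preimage (e s) (e c) (e a) (e u)).
Proof. by rewrite /Preimage; solve_sem. Qed.

#[local] Hint Resolve sem_Preimage sem_Two : sem.

Definition continuous_projections (t c x y : M) :=
  forall a, a ∈ x -> forall u, u ⊆ y -> exists s, s ∈ t /\ preimage s c a u.

Lemma sem_ContinuousProjections t c x y : sem (ContinuousProjections t c x y)
  (fun e : nat -> M => continuous_projections (e t) (e c) (e x) (e y)).
Proof. by rewrite /ContinuousProjections; solve_sem. Qed.

#[local] Hint Resolve sem_ContinuousProjections : sem.

Definition cantor_cube (c t x : M) :=
  [/\ forall f, f ∈ c <-> func f x two, topology t c, continuous_projections t c x two &
      forall t', topology t' c -> continuous_projections t' c x two -> t ⊆ t'].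

Lemma sem_CantorCube c t x :
  sem (CantorCube c t x) (fun e : nat -> M => cantor_cube (e c) (e t) (e x)).
Proof.
rewrite /CantorCube /FunSpace; solve_sem => e; split=> [[z [-> [cP [tc [tp tmin]]]]]|[cP tc tp tmin]].
  by split=> // t' t'c t'p; apply: tmin.
by exists two; do 4 split=> //; move=> t' [t'c t'p]; apply: tmin.
Qed.

Lemma one_neq0 : one <> empty.
Proof. by move=> E; have : empty ∈ one by [rewrite in_pair; left]; rewrite E in_empty. Qed.

Context (X c : M).
Hypothesis cP : forall f, f ∈ c <-> func f X two.

Lemma cube_zero f x : f ∈ c -> x ∈ X -> (opair x empty ∈ f <-> opair x one ∉ f).
Proof.
move=> /cP[_ ftot] /ftot[b [b2 xb xbP]]; split=> [x0 x1|x1].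
  by apply: one_neq0; rewrite (xbP _ x0) (xbP _ x1).
by move: b2 xb; rewrite in_pair => -[->|->].
Qed.

Lemma cube_ext f g : f ∈ c -> g ∈ c ->
  (forall x, x ∈ X -> (opair x one ∈ f <-> opair x one ∈ g)) -> f = g.
Proof.
suff H f' g' : f' ∈ c -> g' ∈ c ->
    (forall x, x ∈ X -> (opair x one ∈ f' <-> opair x one ∈ g')) -> f' ⊆ g'.
  move=> fc gc fg; apply: set_ext => p; split; apply: H => // x /fg fgx.
  by rewrite fgx.
move=> fc gc fg p pf; have [/(_ p pf)[x [b [xX b2 pE]]] _] := (cP f').1 fc.
move: b2 pf; rewrite pE in_pair => -[->|->]; last by move/(fg x xX).
by rewrite (cube_zero fc) // (cube_zero gc) // fg.
Qed.

Lemma cube_char b : exists f, f ∈ c /\ forall x, x ∈ X -> (opair x one ∈ f <-> x ∈ b).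
Proof.
pose f := sep (fun p => exists x, (x ∈ b /\ p = opair x one) \/ (x ∉ b /\ p = opair x empty))
  (prod X two).
have inf x y : opair x y ∈ f <-> x ∈ X /\ ((x ∈ b /\ y = one) \/ (x ∉ b /\ y = empty)).
  rewrite in_sep; last by solve_def.
  rewrite in_prod_opair in_pair; split=> [[[xX _] [x' H]]|[xX H]].
    by split=> //; case: H => -[xb /opair_inj[E1 E2]]; subst; [left|right].
  split; first by split=> //; case: H => -[_ ->]; [right|left].
  by exists x; case: H => -[xb ->]; [left|right].
exists f; split=> [|x xX]; last first.
  rewrite inf; split=> [[_ [[]//|[_ /one_neq0//]]]|xb]; split=> //; by left.
apply/cP; split=> [p|x xX].
  rewrite in_sep; last by solve_def.
  by rewrite in_prod => -[[x [y [? ? ?]]] _]; exists x, y.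
have [xb|xb] := classic (x ∈ b).
  exists one; split; [by rewrite in_pair; right|by apply/inf; split=> //; left|].
  by move=> b' /inf[_ [[]|[]]].
exists empty; split; [by rewrite in_pair; left|by apply/inf; split=> //; right|].
by move=> b' /inf[_ [[]|[]]].
Qed.

(* A point [f] of the cube is determined by the [x] with [opair x one ∈ f], that
   is, f(x) = 1. *)
Definition cyl (f a : M) : M :=
  sep (fun g => forall x, x ∈ a -> (opair x one ∈ g <-> opair x one ∈ f)) c.

Lemma in_cyl f a g : g ∈ cyl f a =
  (g ∈ c /\ forall x, x ∈ a -> (opair x one ∈ g <-> opair x one ∈ f)).
Proof. by rewrite in_sep // /one; solve_def. Qed.

(** Induction on [a]: each new coordinate intersects the cylinder with the preimage of 1 or with its
    complement, which is the preimage of 0. *)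
Lemma clopen_cyl t f a : topology t c -> continuous_projections t c X two ->
  f ∈ c -> fin a -> a ⊆ X -> clopen (cyl f a) t c.
Proof.
move=> tc tp fc fa; move: a fa; apply: fin_ind.
- by rewrite /clopen /cyl /one; solve_def.
- move=> _; suff -> : cyl f empty = c by apply: clopen_self.
  apply: set_ext => g; rewrite in_cyl; split=> [[]//|gc]; split=> // x.
  by rewrite in_empty.
move=> a x _ xa IH axX.
have aX : a ⊆ X by move=> z za; apply: axX; rewrite in_adj; left.
have xX : x ∈ X by apply: axX; rewrite in_adj; right.
have [|s [st sP]] := tp x xX (pair one one).
  by move=> z; rewrite !in_pair => -[->|->]; right.
have [|s' [st' sP']] := tp x xX (pair empty empty).
  by move=> z; rewrite !in_pair => -[->|->]; left.
have ins g : g ∈ s <-> g ∈ c /\ opair x one ∈ g.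
  rewrite sP; split=> [[gc [y []]]|[gc gx]].
    by rewrite in_pair => -[->|->].
  by split=> //; exists one; rewrite in_pair; split=> //; left.
have sc : clopen s t c.
  split=> //; suff -> : diff c s = s' by [].
  apply: set_ext => g; rewrite in_diff ins sP'; split=> [[gc gs]|[gc [y []]]].
    split=> //; exists empty; rewrite in_pair (cube_zero gc) //; split; first by left.
    by move=> gx; apply: gs.
  rewrite in_pair => yE; have -> : y = empty by case: yE.
  by rewrite (cube_zero gc) // => gx; split=> // -[].
have inxs z : z ∈ adj a x = (z ∈ a \/ z = x) by rewrite in_adj.
have [fx|fx] := classic (opair x one ∈ f).
  suff -> : cyl f (adj a x) = cap (cyl f a) s by apply: clopen_cap => //; apply: IH.
  apply: set_ext => g; rewrite in_cap !in_cyl ins; split=> [[gc gf]|[[gc gf] [_ gx]]].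
    split; split=> //; first by move=> z za; apply: gf; rewrite inxs; left.
    by apply/gf => //; rewrite inxs; right.
  by split=> // z; rewrite inxs => -[/gf//|->].
suff -> : cyl f (adj a x) = cap (cyl f a) (diff c s).
  by apply: clopen_cap => //; [apply: IH | apply: clopen_diff].
apply: set_ext => g; rewrite in_cap !in_cyl in_diff ins; split=> [[gc gf]|[[gc gf] [_ gx]]].
  split; split=> //; first by move=> z za; apply: gf; rewrite inxs; left.
  by move=> [_ gx]; apply: fx; apply/gf => //; rewrite inxs; right.
split=> // z; rewrite inxs => -[/gf//|->]; split=> // gx'.
by case: gx.
Qed.

(** An explicit form of the product topology, serving both to construct a cube and to describe the
    open sets of any given one. *)
Definition cyl_topology : M :=
  sep (fun u => forall f, f ∈ u -> exists a, [/\ fin a, a ⊆ X & cyl f a ⊆ u]) (pow c).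

Lemma in_cyl_topology u : u ∈ cyl_topology =
  (u ⊆ c /\ forall f, f ∈ u -> exists a, [/\ fin a, a ⊆ X & cyl f a ⊆ u]).
Proof.
by rewrite in_sep ?in_pow // /cyl /one; solve_def.
Qed.

Lemma cyl_topology_topology : topology cyl_topology c.
Proof.
split.
- by move=> u; rewrite in_cyl_topology => -[].
- by rewrite in_cyl_topology; split=> f; rewrite in_empty.
- rewrite in_cyl_topology; split=> // f fc; exists empty; split; first exact: fin_empty.
    by move=> z; rewrite in_empty.
  by move=> g; rewrite in_cyl => -[].
- move=> F FP; rewrite in_cyl_topology; split=> [f|f]; rewrite in_bigcup => -[u [uF fu]].
    by move: (FP u uF); rewrite in_cyl_topology => -[uc _]; apply: uc.
  move: (FP u uF); rewrite in_cyl_topology => -[_ /(_ f fu)[a [fa aX au]]].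
  by exists a; split=> // g /au gu; rewrite in_bigcup; exists u.
- move=> u v; rewrite !in_cyl_topology => -[uc uP] [vc vP].
  split=> f; rewrite in_cap => -[fu fv]; first exact: uc.
  have [a [fa aX au]] := uP f fu; have [b [fb bX bv]] := vP f fv.
  exists (cup a b); split; first exact: fin_cup.
    by move=> z; rewrite in_cup => -[/aX|/bX].
  move=> g; rewrite in_cap in_cyl => -[gc gf]; split.
    by apply: au; rewrite in_cyl; split=> // x xa; apply: gf; rewrite in_cup; left.
  by apply: bv; rewrite in_cyl; split=> // x xa; apply: gf; rewrite in_cup; right.
Qed.

Lemma cyl_topology_projections : continuous_projections cyl_topology c X two.
Proof.
move=> x xX u u2.
pose s := sep (fun f => exists y, y ∈ u /\ opair x y ∈ f) c.
have ins f : f ∈ s = (f ∈ c /\ exists y, y ∈ u /\ opair x y ∈ f) by rewrite in_sep //; solve_def.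
exists s; split; last by move=> f; rewrite ins.
rewrite in_cyl_topology; split=> f; rewrite ins => -[fc] // [y [yu xy]].
exists (adj empty x); split; first exact/fin_adj/fin_empty.
  by move=> z; rewrite in_adj in_empty => -[//|->].
move=> g; rewrite in_cyl ins => -[gc gf]; split=> //; exists y; split=> //.
have {}gf : opair x one ∈ g <-> opair x one ∈ f by apply: gf; rewrite in_adj; right.
move: (u2 y yu) xy; rewrite in_pair => -[->|->]; last by move/gf.
by rewrite (cube_zero gc) // (cube_zero fc) // gf.
Qed.

(** Minimality: cylinders over finite sets are open in every topology with continuous projections,
    hence so are all sets that contain a cylinder around each point. *)
Lemma cyl_topology_cube : cantor_cube c cyl_topology X.
Proof.
split=> //; [exact: cyl_topology_topology|exact: cyl_topology_projections|].
move=> t tc tp u; rewrite in_cyl_topology => -[uc uP].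
apply: (open_local tc) => f fu; have [a [fa aX au]] := uP f fu.
exists (cyl f a); split=> //; last by rewrite in_cyl; split=> //; apply: uc.
by case: (clopen_cyl tc tp (uc _ fu) fa aX).
Qed.

(** By its minimality, the given topology is contained in [cyl_topology]. *)
Lemma open_cyl t u f : cantor_cube c t X -> u ∈ t -> f ∈ u ->
  exists a, [/\ fin a, a ⊆ X & cyl f a ⊆ u].
Proof.
move=> [_ _ _ tmin] ut fu.
have := tmin _ cyl_topology_topology cyl_topology_projections u ut.
by rewrite in_cyl_topology => -[_]; apply.
Qed.

End CantorCubes.

#[local] Hint Resolve sem_Two sem_CantorCube : sem.

(** Condition (iv) speaks about every cube over [X]; to draw a conclusion from it, one has to
    exist. *)
Lemma cantor_cube_ex {M : zf_model} (X : M) : exists c t, cantor_cube c t X.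
Proof.
pose c := sep (fun f => func f X two) (pow (prod X two)).
suff cP f : f ∈ c <-> func f X two.
  by exists c, (cyl_topology X c); apply: cyl_topology_cube.
rewrite in_sep; last by rewrite /func; solve_def.
split=> [[]//|fX]; split=> //; rewrite in_pow => p /(fX.1)[a [b [? ? ->]]].
by rewrite in_prod_opair.
Qed.

(** * The implications *)

Section FinSubsetsToZeroDimensional.
Context {M : zf_model} (X t : M).
Hypothesis tX : topology t X.
Let B : M := sep (fun u => clopen u t X) t.

Let inB u : u ∈ B <-> clopen u t X.
Proof. by rewrite in_sep; [split=> [[]//|[]]|rewrite /clopen; solve_def]. Qed.

(** Clopen sets separate points, so sending a point to the set of clopen sets containing it embeds
    [X] into the power set of [B]. *)
Lemma clopen_algebra_infinite :
  ~ fin X -> zero_dimensional t X -> hausdorff t X -> ~ fin B.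
Proof.
move=> Xinf zd haus Bfin; apply: Xinf.
have din x : drel1 (fun u : M => x ∈ u) by solve_def.
have dF : dfun1 (fun x : M => sep (fun u => x ∈ u) B) by solve_def.
apply: (fin_inj dF (fin_pow Bfin)) => [x xX|x y xX yX xy].
  by rewrite in_pow => u; rewrite in_sep // => -[].
apply: NNPP => nxy; have [u [v [ut vt xu yv uv]]] := haus x y xX yX nxy.
have [w [wc xw wu]] := zd u x ut xu.
have : w ∈ sep (fun u => y ∈ u) B by rewrite -xy in_sep // inB.
by rewrite in_sep // => -[_ /wu yu]; apply: (uv y).
Qed.

(** The class of [x] is a finite intersection of members of [K] and of complements of members. *)
Lemma clopen_indistinguishable K x : fin K -> K ⊆ B ->
  clopen (sep (fun y => forall u, u ∈ K -> (x ∈ u <-> y ∈ u)) X) t X.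
Proof.
have inS L y : y ∈ sep (fun y => forall u, u ∈ L -> (x ∈ u <-> y ∈ u)) X =
    (y ∈ X /\ forall u, u ∈ L -> (x ∈ u <-> y ∈ u)).
  by rewrite in_sep //; solve_def.
move: K; apply: fin_ind; first by rewrite /clopen; solve_def.
  move=> _; suff -> : sep (fun y => forall u, u ∈ empty -> (x ∈ u <-> y ∈ u)) X = X.
    exact: clopen_self.
  by apply: set_ext => y; rewrite inS; split=> [[]//|yX]; split=> // u; rewrite in_empty.
move=> a u _ _ IH auB.
have aB : a ⊆ B by move=> w wa; apply: auB; rewrite in_adj; left.
have /inB uc : u ∈ B by apply: auB; rewrite in_adj; right.
have [xu|xu] := classic (x ∈ u).
  suff -> : sep (fun y => forall w, w ∈ adj a u -> (x ∈ w <-> y ∈ w)) X =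
      cap (sep (fun y => forall w, w ∈ a -> (x ∈ w <-> y ∈ w)) X) u.
    by apply: clopen_cap => //; apply: IH.
  apply: set_ext => y; rewrite in_cap !inS; split=> [[yX yP]|[[yX yP] yu]].
    split; last by apply/yP => //; rewrite in_adj; right.
    by split=> // w wa; apply: yP; rewrite in_adj; left.
  by split=> // w; rewrite in_adj => -[/yP//|->].
suff -> : sep (fun y => forall w, w ∈ adj a u -> (x ∈ w <-> y ∈ w)) X =
    cap (sep (fun y => forall w, w ∈ a -> (x ∈ w <-> y ∈ w)) X) (diff X u).
  by apply: clopen_cap => //; [apply: IH | apply: clopen_diff].
apply: set_ext => y; rewrite in_cap in_diff !inS; split=> [[yX yP]|[[yX yP] [_ yu]]].
  split; first by split=> // w wa; apply: yP; rewrite in_adj; left.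
  by split=> // yu; apply: xu; apply/yP => //; rewrite in_adj; right.
by split=> // w; rewrite in_adj => -[/yP//|->].
Qed.

Context (d : M) (R : M -> M -> Prop).
Hypotheses (dR : drel2 R) (Rd : corr R d omega) (dw : equip d omega).
Hypothesis Rw : forall a i, R a i -> a ∈ d /\ i ∈ omega.
Hypothesis dB : forall a, a ∈ d -> a ⊆ B /\ fin a.

(** Since [R a i] says that [a] is the finite set F_i, this collects the clopen sets that define
    n-equivalence. *)
Let G n : M := bigcup (sep (fun a => exists i, i ∈ n /\ R a i) d).

Let inG n u : u ∈ G n <-> exists a i, [/\ u ∈ a, i ∈ n & R a i].
Proof.
rewrite in_bigcup; split=> [[a []]|[a [i [ua ni ai]]]].
  by rewrite in_sep; [move=> [_ [i [ni ai]]] ua; exists a, i | solve_def].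
exists a; rewrite in_sep; last by solve_def.
by split=> //; split; [case: (Rw ai)|exists i].
Qed.

Let dG : dfun1 G. Proof. by rewrite /G; solve_def. Qed.

Let finG n : n ∈ omega -> fin (G n).
Proof.
have dP : drel1 (fun a => exists i, i ∈ n /\ R a i) by solve_def.
move=> nw; apply: fin_bigcup; last by move=> a; rewrite in_sep // => -[/dB[]].
apply: (@fin_image _ (fun i a => R a i) n) => [|||a]; first by solve_def.
- exact: fin_nat.
- move=> i a a' ni; rewrite !in_sep // => -[ad _] [ad' _] ai ai'.
  have [_ _ Ri] := Rd; have [_ iw] := Rw ai.
  by apply/(Ri a i a' i).
- by rewrite in_sep // => -[].
Qed.

Let GB n : G n ⊆ B.
Proof. by move=> u /inG[a [i [ua _ ai]]]; have [ad _] := Rw ai; apply: (dB ad).1. Qed.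

Let eqv n x y := forall u, u ∈ G n -> (x ∈ u <-> y ∈ u).

Let eqv_sub m n x y : m ⊆ n -> eqv n x y -> eqv m x y.
Proof.
move=> mn nxy u /inG[a [i [ua im ai]]]; apply: nxy; apply/inG.
by exists a, i; split=> //; apply: mn.
Qed.

(** Otherwise all F_i consist of clopen sets saturated under N-equivalence. There are only finitely
    many of those, so [d] would be contained in the power set of a finite set. *)
Lemma eqv_unstable N : N ∈ omega -> exists m x y,
  [/\ m ∈ omega, x ∈ X, y ∈ X, eqv N x y & ~ eqv m x y].
Proof.
move=> Nw; apply: NNPP => nex.
have stab m x y : m ∈ omega -> x ∈ X -> y ∈ X -> eqv N x y -> eqv m x y.
  by move=> *; apply: NNPP => ?; apply: nex; exists m, x, y.
pose U := sep (fun u => forall x y, x ∈ u -> y ∈ X -> eqv N x y -> y ∈ u) B.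
have inU u : u ∈ U <-> u ∈ B /\ forall x y, x ∈ u -> y ∈ X -> eqv N x y -> y ∈ u.
  by rewrite in_sep // /eqv; solve_def.
have uX u : u ∈ B -> u ⊆ X by move=> /inB[ut _]; case: tX => tX' _ _ _ _; apply: tX'.
apply: (@denumerable_infinite _ d (pow U)) => // [a ad|].
  rewrite in_pow => u ua; apply/inU; have [aB fa] := dB ad; split; first exact: aB.
  (* The set with index [i] enters [G] only at the successor of [i]. *)
  move=> x y xu yX xy; have [Ra _ _] := Rd; have [i [iw ai]] := Ra a ad.
  have ux := uX u (aB _ ua); apply/(stab (adj i i) x y) => //; last 1 first.
  - by apply/inG; exists a, i; split=> //; rewrite in_adj; right.
  - exact: omegaS.
  - exact: ux.
apply: fin_pow.
pose phi (x : M) := sep (fun w => x ∈ w) (G N).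
have inphi x w : w ∈ phi x = (w ∈ G N /\ x ∈ w) by rewrite in_sep //; solve_def.
have dphi : dfun1 phi by rewrite /phi; solve_def.
have dF : dfun1 (img phi) by solve_def.
(* A saturated set is determined by which types [phi x] its points realise, and a type is a subset
   of the finite set [G N]. *)
apply: (fin_inj dF (fin_pow (fin_pow (finG Nw)))) => [u _|u v].
  rewrite in_pow => p; rewrite in_img // => -[x [_ ->]].
  by rewrite in_pow => w; rewrite inphi => -[].
suff H u' v' : u' ∈ U -> v' ∈ U -> img phi u' = img phi v' -> u' ⊆ v'.
  by move=> uU vU uv; apply: set_ext => x; split; apply: H.
move=> /inU[uB _] /inU[vB vP] uv x xu.
have : phi x ∈ img phi v' by rewrite -uv in_img //; exists x.
rewrite in_img // => -[y [yv xy]]; apply: (vP y) => //; first exact: uX xu.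
move=> w wG; have : w ∈ phi x <-> w ∈ phi y by rewrite xy.
by rewrite !inphi; tauto.
Qed.

Let cell n x := sep (fun y => eqv n x y) X.

Let in_cell n x y : y ∈ cell n x = (y ∈ X /\ eqv n x y).
Proof. by rewrite in_sep // /eqv; solve_def. Qed.

Let clopen_cell n x : n ∈ omega -> clopen (cell n x) t X.
Proof. by move=> nw; apply: clopen_indistinguishable; [apply: finG|apply: GB]. Qed.

(** The differences of consecutive classes of [x] are open and disjoint; a point that leaves the
    class of [x] late makes a late difference nonempty. *)
Lemma cellular_of_unstable_point x : x ∈ X ->
  (forall n, n ∈ omega -> exists m y, [/\ m ∈ omega, y ∈ X, eqv n x y & ~ eqv m x y]) ->
  exists c, equip c omega /\ cellular c t.
Proof.
move=> xX xP; pose V n := diff (cell n x) (cell (adj n n) x).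
have inV n y : y ∈ V n <-> [/\ y ∈ X, eqv n x y & ~ eqv (adj n n) x y].
  rewrite in_diff !in_cell; split=> [[[yX ny] nSy]|[yX ny nSy]]; split=> //.
    by move=> Sy; apply: nSy.
  by case.
have tI : forall u v, clopen u t X -> clopen v t X -> diff u v ∈ t.
  move=> u v uc vc; have [tX' _ _ _ _] := tX.
  have [+ _] := clopen_cap tX uc (clopen_diff tX vc); congr (_ ∈ t).
  apply: set_ext => z; rewrite in_cap !in_diff; split=> [[zu [_ zv]]//|[zu zv]].
  by split=> //; split=> //; case: uc => ut _; apply: tX' zu.
have succ_sub m n : n ∈ omega -> m ∈ n -> adj m m ⊆ n.
  by move=> nw mn i; rewrite in_adj => -[/(nat_trans nw mn)|->].
apply: (@cellularI _ t V).
- by rewrite /V /cell /eqv; solve_def.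
- by move=> n nw; apply: tI; apply: clopen_cell => //; apply: omegaS.
- suff H m n y : n ∈ omega -> y ∈ V m -> y ∈ V n -> m ∉ n.
    move=> m n y mw nw ym yn; case: (nat_total mw nw) => // mn.
      by case: (H m n y).
    by case: (H n m y).
  move=> nw /inV[_ _ nSm] /inV[_ ny _] mn; apply: nSm; apply: eqv_sub ny.
  exact: succ_sub.
(* Starting from the successor of [N] forces the first separating stage, the successor of [j], to
   give [j] strictly above [N]. *)
move=> N Nw; have [m [y [mw yX Sy nmy]]] := xP _ (omegaS Nw).
have dP : drel1 (fun k => ~ eqv k x y) by rewrite /eqv; solve_def.
have [k [kw nky kmin]] := least dP mw nmy.
have [k0|[j [jw kj]]] := nat_pred kw.
  by case: nky => u /inG[a [i [_]]]; rewrite k0 in_empty.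
have jy : eqv j x y by apply: NNPP; apply: kmin; rewrite kj in_adj; right.
rewrite kj in nky; exists j; split=> //; last by exists y; apply/inV.
case: (nat_total Nw jw) => // [Nj|jN]; case: nky; first by rewrite -Nj.
apply: eqv_sub Sy => i; rewrite !in_adj => -[ij|->]; left=> //.
exact: nat_trans jN ij.
Qed.

(** Stability at [n] is invariant under n-equivalence, so [V n] contains the n-class of each of its
    points and is open. *)
Lemma cellular_of_stable_points :
  (forall x, x ∈ X -> exists n, n ∈ omega /\
     forall m y, m ∈ omega -> y ∈ X -> eqv n x y -> eqv m x y) ->
  exists c, equip c omega /\ cellular c t.
Proof.
move=> xP; pose stable n x := forall m y, m ∈ omega -> y ∈ X -> eqv n x y -> eqv m x y.
have dstable : drel2 stable by rewrite /stable /eqv; solve_def.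
have eqvC n x y : eqv n x y -> eqv n y x by move=> xy u /xy ->.
have stable_eqv n x y : y ∈ X -> stable n x -> eqv n x y -> stable n y.
  move=> yX xs xy m z mw zX yz u uG.
  rewrite -(xs m y mw yX xy u uG); apply: xs uG => // w wG.
  by rewrite (xy w wG); apply: yz.
pose V n := sep (fun x => stable n x /\ forall k, k ∈ n -> ~ stable k x) X.
have inV n x : x ∈ V n = (x ∈ X /\ stable n x /\ forall k, k ∈ n -> ~ stable k x).
  by rewrite in_sep //; solve_def.
apply: (@cellularI _ t V).
- by rewrite /V; solve_def.
- move=> n nw; apply: (open_local tX) => x; rewrite inV => -[xX [xs xmin]].
  exists (cell n x); split; [by case: (clopen_cell x nw)|by rewrite in_cell|].
  move=> y; rewrite in_cell inV => -[yX xy]; split=> //.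
  split; first exact: stable_eqv xy.
  move=> k kn ys; apply: (xmin k kn); apply: (stable_eqv k y x) => //; apply: eqvC.
  by apply: eqv_sub xy => i; apply: nat_trans kn.
- suff H m n y : y ∈ V m -> y ∈ V n -> m ∉ n.
    move=> m n y mw nw ym yn; case: (nat_total mw nw) => // mn.
      by case: (H m n y).
    by case: (H n m y).
  by rewrite !inV => -[_ [ym _]] [_ [_ ymin]] /ymin.
(* A point [x] that is N-equivalent to [y] but is later separated from it cannot be stable at [N] or
   earlier. *)
move=> N Nw; have [m [x [y [mw xX yX Ny nmy]]]] := eqv_unstable Nw.
have dP : drel1 (fun n => stable n x) by solve_def.
have [n0 [n0w n0s]] := xP x xX.
have [n [nw ns nmin]] := least dP n0w n0s.
exists n; split=> //; last by exists x; rewrite inV.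
case: (nat_total Nw nw) => // [Nn|nN]; case: nmy; apply: ns => //; first by rewrite -Nn.
by apply: eqv_sub Ny => i; apply: nat_trans nN.
Qed.

Lemma cellular_of_denumerable : exists c, equip c omega /\ cellular c t.
Proof.
have [xP|/not_all_ex_not[x nx]] := classic (forall x, x ∈ X -> exists n, n ∈ omega /\
     forall m y, m ∈ omega -> y ∈ X -> eqv n x y -> eqv m x y).
  exact: cellular_of_stable_points.
have [xX {}nx] := imply_to_and _ _ nx.
apply: (cellular_of_unstable_point xX) => n nw; apply: NNPP => nmy; apply: nx.
exists n; split=> // m y mw yX nxy; apply: NNPP => mxy; apply: nmy.
by exists m, y.
Qed.

End FinSubsetsToZeroDimensional.

(** * The four conditions inside a model, and the implications up to (iv) *)

Section Conditions.
Context (M : zf_model).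

Definition fin_subsets_condition := forall X : M, ~ fin X -> forall z,
  (forall a, a ∈ z <-> a ⊆ X /\ fin a) -> exists d, d ⊆ z /\ equip d omega.

Definition cellular_family (t : M) := exists c, equip c omega /\ cellular c t.

Definition zero_dimensional_condition := forall X t : M,
  topology t X /\ ~ fin X /\ zero_dimensional t X /\ hausdorff t X -> cellular_family t.

Definition cantor_subspace_condition := forall X : M, ~ fin X -> forall c t,
  cantor_cube c t X -> forall Y, Y ⊆ c /\ ~ fin Y -> forall s,
  (forall v, v ∈ s <-> exists u, u ∈ t /\ v = cap u Y) -> cellular_family s.

Definition cantor_cube_condition := forall X : M, ~ fin X -> forall c t,
  cantor_cube c t X -> cellular_family t.

Lemma zero_dimensional_of_fin_subsets :
  fin_subsets_condition -> zero_dimensional_condition.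
Proof.
move=> fsP X t [tX [Xinf [zd haus]]].
pose B := sep (fun u => clopen u t X) t.
have Binf : ~ fin B by apply: clopen_algebra_infinite.
have dfin : drel1 (@fin M) by solve_def.
have [a|d [dz dw]] := fsP B Binf (sep (@fin M) (pow B)).
  by rewrite in_sep // in_pow.
have [R [dR Rd Rw]] := equipE dw.
apply: (cellular_of_denumerable tX dR Rd dw Rw) => a /dz.
by rewrite in_sep // in_pow.
Qed.

Lemma cantor_subspace_of_zero_dimensional :
  zero_dimensional_condition -> cantor_subspace_condition.
Proof.
move=> zdP X _ c t cube Y [Yc Yinf] s sP; have [cP tc tp _] := cube.
have [tsub t0 ct tU tI] := tc.
apply: (zdP Y s); split; last split=> //; last split.
- split.
  + by move=> v /sP[u [_ ->]] f; rewrite in_cap => -[].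
  + apply/sP; exists empty; split=> //.
    by apply: set_ext => f; rewrite in_cap in_empty; tauto.
  + apply/sP; exists c; split=> //.
    by apply: set_ext => f; rewrite in_cap; split=> [fY|[]//]; split=> //; apply: Yc.
  + move=> F Fs; apply/sP.
    have dP : drel1 (fun u => cap u Y ∈ F) by solve_def.
    (* All open sets with trace in [F] are taken together, since picking one for each member would
       need choice. *)
    exists (bigcup (sep (fun u => cap u Y ∈ F) t)); split.
      by apply: tU => u; rewrite in_sep // => -[].
    apply: set_ext => f; rewrite in_cap !in_bigcup; split.
      move=> [v [vF fv]]; have /sP[u [ut vE]] := Fs v vF.
      move: (fv); rewrite {1}vE in_cap => -[fu fY]; split=> //.
      by exists u; rewrite in_sep // -vE.
    move=> [[u []]]; rewrite in_sep // => -[ut uF] fu fY.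
    by exists (cap u Y); rewrite in_cap.
  + move=> v w /sP[v' [vt ->]] /sP[w' [wt ->]]; apply/sP; exists (cap v' w').
    split; first exact: tI.
    by apply: set_ext => f; rewrite !in_cap; tauto.
- move=> v f /sP[u [ut ->]]; rewrite in_cap => -[fu fY].
  have [a [fa aX au]] := open_cyl cP cube ut fu.
  have [wt wt'] := clopen_cyl cP tc tp (Yc f fY) fa aX.
  exists (cap (cyl c f a) Y); split.
  + split; apply/sP; first by exists (cyl c f a).
    exists (diff c (cyl c f a)); split=> //; apply: set_ext => g.
    rewrite !(in_cap, in_diff); split=> [[gY ng]|[[gc ng] gY]].
      by split=> //; split=> [|ga]; [apply: Yc | apply: ng].
    by split=> // -[].
  + by rewrite in_cap in_cyl; split=> //; split=> //; apply: Yc.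
  + by move=> g; rewrite !in_cap => -[/au].
- move=> f g fY gY fg.
  (* Distinct points differ at some coordinate [x]; the cylinders over this single coordinate
     separate them. *)
  have [x [xX xfg]] : exists x, x ∈ X /\ ~ (opair x one ∈ f <-> opair x one ∈ g).
    apply: NNPP => nx; apply: fg; apply: (cube_ext cP) => [||x xX]; try exact: Yc.
    by apply: NNPP => nfg; apply: nx; exists x.
  have fx : fin (adj empty x) by apply/fin_adj/fin_empty.
  have xX' : adj empty x ⊆ X by move=> y; rewrite in_adj in_empty => -[//|->].
  have opn h : h ∈ Y -> cap (cyl c h (adj empty x)) Y ∈ s.
    move=> hY; apply/sP; exists (cyl c h (adj empty x)); split=> //.
    by case: (clopen_cyl cP tc tp (Yc h hY) fx xX').
  have mem h : h ∈ Y -> h ∈ cap (cyl c h (adj empty x)) Y.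
    by move=> hY; rewrite in_cap in_cyl; split=> //; split=> //; apply: Yc.
  exists (cap (cyl c f (adj empty x)) Y), (cap (cyl c g (adj empty x)) Y).
  split; [exact: opn|exact: opn|exact: mem|exact: mem|].
  move=> h; rewrite !in_cap !in_cyl => -[[[_ hf] _] [[_ hg] _]]; apply: xfg.
  by rewrite -hf ?hg //; rewrite in_adj; right.
Qed.

(** The cube is regarded as a subspace of itself. It is infinite because the characteristic
    functions of singletons are matched with the points of [X]. *)
Lemma cantor_cube_of_subspace : cantor_subspace_condition -> cantor_cube_condition.
Proof.
move=> csP X Xinf c t cube; have [cP [tsub _ _ _ _] _ _] := cube.
apply: (csP X Xinf c t cube c) => [|v]; last first.
  have capE u : u ∈ t -> cap u c = u.
    move=> ut; apply: set_ext => f; rewrite in_cap; split=> [[]//|fu].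
    by split=> //; apply: tsub fu.
  by split=> [vt|[u [ut ->]]]; [exists v; rewrite capE|rewrite capE].
split=> // cfin; apply: Xinf.
pose R f x := forall y, y ∈ X -> (opair y one ∈ f <-> y = x).
apply: (@fin_image _ R c) => // [|f x x' _ xX xX' fx fx'|x xX].
- by rewrite /R /one; solve_def.
- by apply/(fx' x xX)/(fx x xX).
- have [f [fc fx]] := cube_char cP (pair x x); exists f; split=> // y yX.
  by rewrite fx // in_pair; tauto.
Qed.

End Conditions.

(** * Denumerably many finite sets from a cellular family of the cube *)

Section CantorCubeToFinSubsets.
Context {M : zf_model} (X c t C : M).
Hypotheses (cube : cantor_cube c t X) (Cw : equip C omega) (Ct : cellular C t).

Let cP : forall f, f ∈ c <-> func f X two. Proof. by case: cube. Qed.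
Let tc u : u ∈ t -> u ⊆ c. Proof. by case: cube => _ [tsub _ _ _ _] _ _; apply: tsub. Qed.

(** Codes the restriction of [f] to [A], a function into 2, as a subset of [A]. *)
Let trace f A : M := sep (fun x => opair x one ∈ f) A.

Let in_trace f A x : x ∈ trace f A = (x ∈ A /\ opair x one ∈ f).
Proof. by rewrite in_sep // /one; solve_def. Qed.

Let traceE f g A : trace f A = trace g A ->
  forall x, x ∈ A -> (opair x one ∈ f <-> opair x one ∈ g).
Proof.
move=> fg x xA; have : x ∈ trace f A <-> x ∈ trace g A by rewrite fg.
by rewrite !in_trace; tauto.
Qed.

Let dtrace : dfun2 trace. Proof. by rewrite /trace /one; solve_def. Qed.
Let dcyl : dfun2 (cyl c). Proof. by rewrite /cyl /one; solve_def. Qed.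

Let bad A o := o ∈ C /\ exists o', (o' ∈ C /\ o' <> o) /\
  exists g h, g ∈ o /\ h ∈ o' /\ trace g A = trace h A.

Let dbad : drel2 bad. Proof. by rewrite /bad; solve_def. Qed.

(** If no member were bad, distinct members of [C], being nonempty, would have distinct sets of
    traces on [A], embedding [C] into the double power set of [A]. *)
Lemma bad_ex A : fin A -> exists o, bad A o.
Proof.
move=> fA; apply: NNPP => nbad; apply: (denumerable_infinite Cw (a := C)) => //.
have dF : dfun1 (fun o => img (fun g => trace g A) o) by solve_def.
have dA : dfun1 (fun g => trace g A) by solve_def.
apply: (fin_inj dF (fin_pow (fin_pow fA))) => [o _|o o' oC o'C E].
  rewrite in_pow => b; rewrite in_img // => -[g [_ ->]]; rewrite in_pow => x.
  by rewrite in_trace => -[].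
apply: NNPP => oo'; apply: nbad; exists o; split=> //; exists o'.
split; first by split=> // E'; apply: oo'.
have [_ C0 _] := Ct; case: (empty_or o) => [/(C0 o oC)//|[g go]].
have : trace g A ∈ img (fun g => trace g A) o' by rewrite -E in_img //; exists g.
by rewrite in_img // => -[h [ho' gh]]; exists g, h.
Qed.

(* [pick A] is the bad member of [C] that comes first in the enumeration of [C]. *)
Lemma bad_choice : exists pick : M -> M, dfun1 pick /\ forall A, fin A -> bad A (pick A).
Proof.
have [R [dR [RC Rw Ri] RCw]] := equipE Cw.
pose least_bad A o := bad A o /\ forall o' i j, bad A o' -> R o' i -> R o j -> i ∉ j.
have dlb : drel2 least_bad by rewrite /least_bad; solve_def.
exists (fun A => the (least_bad A)); split; first by solve_def.
move=> A fA; suff [] : least_bad A (the (least_bad A)) by [].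
apply: the_spec; have [o obad] := bad_ex fA; have [i [iw oi]] := RC o obad.1.
have dP : drel1 (fun i => exists o, bad A o /\ R o i) by solve_def.
have [|j [jw [o' [o'bad o'j]] jmin]] := least dP iw; first by exists o.
have RjE k : R o' k -> k = j.
  by move=> o'k; have [o'C kw] := RCw _ _ o'k; apply/(Ri o' k o' j).
exists o'; split.
  split=> // o1 k j' o1bad o1k /RjE -> kj; apply: (jmin k kj).
  by exists o1.
move=> o1 [o1bad o1min]; have [k [kw o1k]] := RC o1 o1bad.1.
have kj : k = j.
  case: (nat_total kw jw) => // [kj|jk]; first by case: (jmin k kj); exists o1.
  by case: (o1min o' j k).
by apply/(Ri o1 k o' j) => //; [case: o1bad|case: o'bad].
Qed.

(** Iterates the map from [A] to [cup A (H A)], starting with the empty set. The work lies in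
    showing that [H A] is finite and contributes a point outside [A]. *)
Lemma denumerable_fin_subsets z : (forall a, a ∈ z <-> a ⊆ X /\ fin a) ->
  exists d, d ⊆ z /\ equip d omega.
Proof.
move=> zP; have [pick [dpick pickP]] := bad_choice.
pose S A b := sep (fun s => (fin s /\ forall x, x ∈ s -> x ∉ A) /\
  exists g, (g ∈ pick A /\ trace g A = b) /\ cyl c g (cup A s) ⊆ pick A) (pow X).
have inS A b s : s ∈ S A b = (s ⊆ X /\ (fin s /\ forall x, x ∈ s -> x ∉ A) /\
  exists g, (g ∈ pick A /\ trace g A = b) /\ cyl c g (cup A s) ⊆ pick A).
  by rewrite in_sep ?in_pow //; solve_def.
have dS : dfun2 S by rewrite /S; solve_def.
(* The union runs over all restrictions [b] and all least hitting sets, so that nothing has to be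
   chosen. *)
pose H A := bigcup (img (fun b => bigcup (least_hitting X (S A b))) (pow A)).
have dH : dfun1 H by rewrite /H; solve_def.
have dHA A : dfun1 (fun b => bigcup (least_hitting X (S A b))) by solve_def.
pose lt (A A' : M) := A ⊆ A' /\ exists x, x ∈ A' /\ x ∉ A.
have dlt : drel2 lt by rewrite /lt; solve_def.
apply: (@iterate _ z empty (fun A => cup A (H A)) lt) => // [||A /zP[AX fA]|A A1 A2|A].
- by solve_def.
- by apply/zP; split; [move=> x; rewrite in_empty|exact: fin_empty].
- split.
    apply/zP; split.
      move=> x; rewrite in_cup => -[/AX//|]; rewrite in_bigcup => -[y []].
      rewrite in_img // => -[b [_ ->]]; rewrite in_bigcup => -[T []].
      by rewrite in_least_hitting => -[TX _] /TX.
    apply: fin_cup => //; apply: fin_bigcup; first exact/fin_img/fin_pow.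
    move=> y; rewrite in_img // => -[b [_ ->]]; apply: fin_least_hitting => s.
    by rewrite inS => -[sX [[]]].
  split; first by move=> x xA; rewrite in_cup; left.
  have [oC [o' [[o'C o'o] [g [h [go [ho' gh]]]]]]] := pickP A fA.
  have [Csub _ Cdisj] := Ct.
  have [a [fa aX ao']] := open_cyl cP cube (Csub _ o'C) ho'.
  have [e [fe eX eo]] := open_cyl cP cube (Csub _ oC) go.
  (* The coordinates of a cylinder contained in [o'] give a finite hitting set, which guarantees
     that least ones exist. *)
  have hit : hits (diff a A) (S A (trace g A)).
    move=> s; rewrite inS => -[sX [[_ sA] [g' [[g'o tg'] g's]]]].
    apply: NNPP => nx.
    (* If [s] missed [a] outside [A], the point [k] agreeing with [g'] on [A] and [s], and with [h]
       elsewhere, would lie in both [pick A] and [o']. *)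
    pose K := sep (fun x => ((x ∈ A \/ x ∈ s) /\ opair x one ∈ g') \/
       (~ (x ∈ A \/ x ∈ s) /\ opair x one ∈ h)) X.
    have inK x : x ∈ K = (x ∈ X /\ (((x ∈ A \/ x ∈ s) /\ opair x one ∈ g') \/
       (~ (x ∈ A \/ x ∈ s) /\ opair x one ∈ h))).
      by rewrite in_sep // /one; solve_def.
    have [k [kc kK]] := cube_char cP K.
    have ko : k ∈ pick A.
      apply: g's; rewrite in_cyl; split=> // x; rewrite in_cup => xAs.
      have xX : x ∈ X by case: xAs => [/AX|/sX].
      by rewrite kK // inK; tauto.
    have ko' : k ∈ o'.
      apply: ao'; rewrite in_cyl; split=> // x xa; rewrite (kK _ (aX _ xa)) inK.
      have [xA|xA] := classic (x ∈ A).
        have := traceE (etrans tg' gh) xA; have := aX _ xa; tauto.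
      have xs : x ∉ s.
        by move=> xs; apply: nx; exists x; rewrite in_diff.
      by have := aX _ xa; tauto.
    by apply: (Cdisj _ _ oC o'C (fun E => o'o (esym E)) k).
  have daX : diff a A ⊆ X by move=> x; rewrite in_diff => -[/aX].
  have fda : fin (diff a A) by apply: (fin_sub fa) => x; rewrite in_diff => -[].
  have [T TH] := least_hitting_ex daX fda hit.
  have := TH; rewrite in_least_hitting => -[TX [Thit _]].
  (* A cylinder around [g] inside [pick A] shows that the family is nonempty; hitting this member
     yields an element outside [A]. *)
  have eS : diff e A ∈ S A (trace g A).
    rewrite inS; split; first by move=> x; rewrite in_diff => -[/eX].
    split; first split.
    + by apply: (fin_sub fe) => x; rewrite in_diff => -[].
    + by move=> x; rewrite in_diff => -[].
    exists g; split=> // k; rewrite in_cyl => -[kc kg]; apply: eo; rewrite in_cyl.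
    split=> // x xe; apply: kg; rewrite in_cup in_diff.
    by have [] := classic (x ∈ A); tauto.
  have [x [xe xT]] := Thit _ eS; exists x; move: xe; rewrite in_diff => -[xe xA].
  split=> //; rewrite in_cup; right; rewrite in_bigcup.
  exists (bigcup (least_hitting X (S A (trace g A)))); split.
    rewrite in_img //; exists (trace g A); split=> //.
    by rewrite in_pow => y; rewrite in_trace => -[].
  by rewrite in_bigcup; exists T.
- move=> [AA1 [x [xA1 xA]]] [A12 _]; split; first by move=> y /AA1 /A12.
  by exists x; split=> //; apply: A12.
- by move=> [_ [x [xA nxA]]].
Qed.

End CantorCubeToFinSubsets.

Lemma fin_subsets_of_cantor_cube (M : zf_model) :
  cantor_cube_condition M -> fin_subsets_condition M.
Proof.
move=> ccP X Xinf z zP; have [c [t cube]] := cantor_cube_ex X.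
have [C [Cw Ct]] := ccP X Xinf c t cube.
exact: (denumerable_fin_subsets cube Cw Ct zP).
Qed.

(** * The formal sentences express the four conditions *)

Section SemanticsConditions.
Context {M : zf_model}.

Lemma sem_DenumerableCellularFamily t :
  sem (DenumerableCellularFamily t) (fun e : nat -> M => cellular_family (e t)).
Proof. by rewrite /DenumerableCellularFamily; solve_sem. Qed.

#[local] Hint Resolve sem_DenumerableCellularFamily : sem.

Lemma sem_Infinite x : sem (Infinite x) (fun e : nat -> M => ~ fin (e x)).
Proof. by rewrite /Infinite; solve_sem. Qed.

#[local] Hint Resolve sem_Infinite : sem.

Lemma sem_FinSubsets z x : sem (FinSubsets z x)
  (fun e : nat -> M => forall a, a ∈ e z <-> a ⊆ e x /\ fin a).
Proof. by rewrite /FinSubsets; solve_sem. Qed.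

#[local] Hint Resolve sem_FinSubsets : sem.

Lemma sem_FinSubsets_condition :
  sem FinSubsets_condition (fun _ : nat -> M => fin_subsets_condition M).
Proof. by rewrite /FinSubsets_condition; solve_sem. Qed.

Lemma sem_ZeroDimensional_condition :
  sem ZeroDimensional_condition (fun _ : nat -> M => zero_dimensional_condition M).
Proof. by rewrite /ZeroDimensional_condition; solve_sem. Qed.

Lemma sem_CantorSubspace_condition :
  sem CantorSubspace_condition (fun _ : nat -> M => cantor_subspace_condition M).
Proof. by rewrite /CantorSubspace_condition; solve_sem. Qed.

Lemma sem_CantorCube_condition :
  sem CantorCube_condition (fun _ : nat -> M => cantor_cube_condition M).
Proof. by rewrite /CantorCube_condition; solve_sem. Qed.

End SemanticsConditions.

Theorem theorem4p7 :
  ZF ⊢ (FinSubsets_condition ⇔ ZeroDimensional_condition)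
     ∧ (ZeroDimensional_condition ⇔ CantorSubspace_condition)
     ∧ (CantorSubspace_condition ⇔ CantorCube_condition).
Proof.
apply: completeness => U E ax e.
pose M := ZFModel (e 0) ax.
have iff_sem := sem_And
  (sem_Iff (@sem_FinSubsets_condition M) (@sem_ZeroDimensional_condition M))
  (sem_And (sem_Iff (@sem_ZeroDimensional_condition M) (@sem_CantorSubspace_condition M))
           (sem_Iff (@sem_CantorSubspace_condition M) (@sem_CantorCube_condition M))).
apply/(iff_sem e) => /=.
(* The implications close the cycle (i), (ii), (iii), (iv), (i), from which the equivalences follow
   propositionally. *)
have := @zero_dimensional_of_fin_subsets M.
have := @cantor_subspace_of_zero_dimensional M.
have := @cantor_cube_of_subspace M.
have := @fin_subsets_of_cantor_cube M.
tauto.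
Qed.
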